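(* Fix $n,k\ge1$. Then, as formal power series in $x_1,\ldots,x_n,y_1,\ldots,y_n$, \[\sum_{\bm{\lambda}}t^{d(\bm{\lambda})}\mathcal{L}_{\bm{\lambda}}(x_1,\ldots,x_n;t)\,\mathcal{L}_{\bm{\lambda}}(y_1,\ldots,y_n;t)=\prod_{i,j=1}^n\prod_{m=0}^{k-1}\left(1-x_iy_jt^m\right)^{-1},\] where the sum is over all $k$-tuples $\bm{\lambda}=(\lambda^{(1)},\ldots,\lambda^{(k)})$ of partitions each with $n$ non-negative parts, and \[d(\bm{\lambda})=\binom n2\binom k2-\#\{(i,j,a,b):1\le i,j\le n,\ 1\le a<b\le k,\ \lambda^{(b)}_i-i<\lambda^{(a)}_j-j\}.\]
   Context: $\mathcal{L}_{\bm{\lambda}}$ is the coinversion LLT polynomial of $\bm{\lambda}$ (i.e. of $\bm{\lambda}/\bm 0$ with each $\lambda^{(a)}$ and the zero partition having $n$ parts): cells are $(r,c)\in\mathbb{Z}^2$ (row $r$, column $c$, rows bottom to top), $\lambda^{(a)}$ consists of cells $(r,c)$ with $1\le r\le n$, $1\le c\le\lambda^{(a)}_r$, content of $(r,c)$ is $c-r$. A tableau $T=(T^{(1)},\ldots,T^{(k)})$ fills each $\lambda^{(a)}$ with entries in $[n]$, weakly increasing along rows and strictly increasing up columns; $x^T=\prod_u x_{T(u)}$. A triple is $(u,v,w)$ where for some $a<b$: $v$ is a cell of $\lambda^{(a)}$, $u=(r,c-1)$, $w=(r,c)$ with $1\le r\le n$, $w$ of the same content as $v$, $c\ge1$, $c\le\lambda^{(b)}_r+1$.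 With $b'$ the entry of $v$, $a'$ the entry of $u$ in $T^{(b)}$ (or $0$ if $u\notin\lambda^{(b)}$), $c'$ the entry of $w$ in $T^{(b)}$ (or $\infty$ if $w\notin\lambda^{(b)}$), it is a coinversion triple if $a'\le b'\le c'$. $\mathcal{L}_{\bm{\lambda}}=\sum_Tt^{\mathrm{coinv}(T)}x^T$, $\mathrm{coinv}(T)$ the number of coinversion triples. *)

(* Defs.v *)
From HB Require Import structures.
From mathcomp Require Import all_boot all_order all_algebra.
From mathcomp Require Import boolp.
From mathcomp Require Import mpoly.

Set Implicit Arguments.
Unset Strict Implicit.
Unset Printing Implicit Defensive.

Import GRing.Theory Num.Theory.
Local Open Scope ring_scope.

(** * Formal power series in [n] commuting variables *)

Record fps (n : nat) (R : Type) := FPS { fps_coef : 'X_{1..n} -> R }.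

Notation "{ 'fps' R [ n ] }" := (fps n R)
  (at level 0, R at level 2, n at level 2, format "{ 'fps'  R [ n ] }")
  : type_scope.

Lemma fpsP (n : nat) (R : Type) (f g : {fps R[n]}) :
  (forall m, fps_coef f m = fps_coef g m) -> f = g.
Proof. by case: f g => [f] [g] /= e; congr FPS; apply/funext. Qed.

HB.instance Definition _ (n : nat) (R : Type) := gen_eqMixin {fps R[n]}.
HB.instance Definition _ (n : nat) (R : Type) := gen_choiceMixin {fps R[n]}.

Section FpsZmodule.
Variables (n : nat) (R : zmodType).
Implicit Types f g h : {fps R[n]}.

Definition fps_zero : {fps R[n]} := FPS (fun _ => 0).
Definition fps_opp f : {fps R[n]} := FPS (fun m => - fps_coef f m).
Definition fps_add f g : {fps R[n]} :=
  FPS (fun m => fps_coef f m + fps_coef g m).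

Lemma fps_addA : associative fps_add.
Proof. by move=> f g h; apply: fpsP => m /=; rewrite addrA. Qed.

Lemma fps_addC : commutative fps_add.
Proof. by move=> f g; apply: fpsP => m /=; rewrite addrC. Qed.

Lemma fps_add0 : left_id fps_zero fps_add.
Proof. by move=> f; apply: fpsP => m /=; rewrite add0r. Qed.

Lemma fps_addN : left_inverse fps_zero fps_opp fps_add.
Proof. by move=> f; apply: fpsP => m /=; rewrite addNr. Qed.

HB.instance Definition _ := GRing.isZmodule.Build {fps R[n]}
  fps_addA fps_addC fps_add0 fps_addN.

Lemma fps_coef0 m : fps_coef (0 : {fps R[n]}) m = 0. Proof. by []. Qed.
Lemma fps_coefN f m : fps_coef (- f) m = - fps_coef f m. Proof. by []. Qed.
Lemma fps_coefD f g m : fps_coef (f + g) m = fps_coef f m + fps_coef g m.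
Proof. by []. Qed.
Lemma fps_coefB f g m : fps_coef (f - g) m = fps_coef f m - fps_coef g m.
Proof. by []. Qed.

Lemma fps_coef_sum (I : Type) (r : seq I) (P : pred I) (F : I -> {fps R[n]}) m :
  fps_coef (\sum_(i <- r | P i) F i) m = \sum_(i <- r | P i) fps_coef (F i) m.
Proof. by elim/big_rec2: _ => // i x y _ <-. Qed.

(* [f] is the sum of the family [F] in the sense of formal power series: each
   coefficient receives only finitely many nonzero contributions. *)
Definition fps_has_sum (I : eqType) (F : I -> {fps R[n]}) f : Prop :=
  forall m : 'X_{1..n}, exists s : seq I,
    [/\ uniq s,
        forall i, i \notin s -> fps_coef (F i) m = 0
      & \sum_(i <- s) fps_coef (F i) m = fps_coef f m].

End FpsZmodule.

Section FpsRing.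
Variables (n : nat) (R : comNzRingType).
Implicit Types (f g h : {fps R[n]}) (m : 'X_{1..n}).

Definition fpsC (c : R) : {fps R[n]} :=
  FPS (fun m => if m == 0%MM then c else 0).

Definition fpsX (i : 'I_n) : {fps R[n]} := FPS (fun m => (m == U_(i)%MM)%:R).

Definition fps_mul f g : {fps R[n]} :=
  FPS (fun m => \sum_(l : 'X_{1..n < (mdeg m).+1} | (l <= m)%MM)
                  fps_coef f l * fps_coef g (m - l)%MM).

(* Ring identities are transferred from [{mpoly R[n]}] through truncations. *)
Definition fps_trunc (d : nat) f : {mpoly R[n]} :=
  \sum_(m : 'X_{1..n < d}) fps_coef f m *: 'X_[m].

Lemma mcoeff_trunc d f m :
  (mdeg m < d)%N -> (fps_trunc d f)@_m = fps_coef f m.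
Proof. exact: mcoeff_mpoly. Qed.

Lemma mcoeffM_lin (p q : {mpoly R[n]}) m :
  (p * q)@_m =
    \sum_(l : 'X_{1..n < (mdeg m).+1} | (l <= m)%MM) p@_l * q@_(m - l).
Proof. exact: mcoeff_poly_mul_lin. Qed.

Lemma mdeg_le (l m : 'X_{1..n}) : (l <= m)%MM -> (mdeg l <= mdeg m)%N.
Proof. by move=> le_lm; rewrite -(submK le_lm) mdegD leq_addl. Qed.

Lemma eq_mcoeffM d (p p' q q' : {mpoly R[n]}) m :
  (forall l, (mdeg l < d)%N -> p@_l = p'@_l) ->
  (forall l, (mdeg l < d)%N -> q@_l = q'@_l) ->
  (mdeg m < d)%N -> (p * q)@_m = (p' * q')@_m.
Proof.
move=> ep eq lt_md; rewrite !mcoeffM_lin; apply: eq_bigr => l le_lm.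
rewrite ep ?eq //; first exact: leq_ltn_trans (mdegB _ _) lt_md.
exact: leq_ltn_trans (mdeg_le le_lm) lt_md.
Qed.

Lemma fps_coef_mul d f g m : (mdeg m < d)%N ->
  fps_coef (fps_mul f g) m = (fps_trunc d f * fps_trunc d g)@_m.
Proof.
move=> lt_md; rewrite mcoeffM_lin /=; apply: eq_bigr => l le_lm.
rewrite !mcoeff_trunc //; first exact: leq_ltn_trans (mdegB _ _) lt_md.
exact: leq_ltn_trans (mdeg_le le_lm) lt_md.
Qed.

Lemma fps_coefC (c : R) m : fps_coef (fpsC c) m = if m == 0%MM then c else 0.
Proof. by []. Qed.

Lemma fps_mulC : commutative fps_mul.
Proof.
move=> f g; apply: fpsP => m.
by rewrite !(fps_coef_mul _ _ (ltnSn (mdeg m))) mulrC.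
Qed.

Lemma fps_mulA : associative fps_mul.
Proof.
move=> f g h; apply: fpsP => m; set d := (mdeg m).+1.
have lt_md : (mdeg m < d)%N by [].
rewrite !(fps_coef_mul _ _ lt_md).
transitivity ((fps_trunc d f * (fps_trunc d g * fps_trunc d h))@_m).
  apply: (eq_mcoeffM (d := d)) => // l lt_ld.
  by rewrite mcoeff_trunc // (fps_coef_mul _ _ lt_ld).
rewrite mulrA; apply: (eq_mcoeffM (d := d)) => // l lt_ld.
by rewrite mcoeff_trunc // (fps_coef_mul _ _ lt_ld).
Qed.

Lemma fps_mul1 : left_id (fpsC 1) fps_mul.
Proof.
move=> f; apply: fpsP => m; rewrite (fps_coef_mul _ _ (ltnSn (mdeg m))).
transitivity ((1 * fps_trunc (mdeg m).+1 f)@_m); last first.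
  by rewrite mul1r mcoeff_trunc.
apply: (eq_mcoeffM (d := (mdeg m).+1)) => // l lt_l.
by rewrite mcoeff_trunc //= mcoeff1; case: eqP.
Qed.

Lemma fps_mulDl : left_distributive fps_mul +%R.
Proof.
move=> f g h; apply: fpsP => m; rewrite fps_coefD /= -big_split /=.
by apply: eq_bigr => l _; rewrite mulrDl.
Qed.

Lemma fps_oner_neq0 : fpsC 1 != 0.
Proof.
apply/eqP => /(congr1 (fun f => fps_coef f 0%MM)) /=.
by rewrite eqxx => /eqP; rewrite oner_eq0.
Qed.

HB.instance Definition _ := GRing.Zmodule_isComNzRing.Build {fps R[n]}
  fps_mulA fps_mulC fps_mul1 fps_mulDl fps_oner_neq0.

Lemma fps_coefM f g m : fps_coef (f * g) m =
  \sum_(l : 'X_{1..n < (mdeg m).+1} | (l <= m)%MM)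
     fps_coef f l * fps_coef g (m - l)%MM.
Proof. by []. Qed.

Lemma fps_coef1 m : fps_coef (1 : {fps R[n]}) m = (m == 0%MM)%:R.
Proof. by rewrite [LHS]/=; case: eqP. Qed.

Lemma fps_coefM0 f g :
  fps_coef (f * g) 0%MM = fps_coef f 0%MM * fps_coef g 0%MM.
Proof.
rewrite (@fps_coef_mul 1) ?mdeg0 // mcoeffM_lin.
rewrite (bigD1 bm0) ?lepm_refl //= big1 ?addr0.
  by rewrite subm0 !mcoeff_trunc ?mdeg0.
case=> l lt_l /andP[_]; rewrite /= -val_eqE /= => /eqP nz.
by case: nz; apply/eqP; move: lt_l; rewrite mdeg0 ltnS leqn0 mdeg_eq0.
Qed.

Lemma fpsC_is_zmod_morphism : zmod_morphism fpsC.
Proof.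
by move=> a b; apply: fpsP => m; rewrite fps_coefB !fps_coefC;
   case: eqP; rewrite ?subr0.
Qed.

Lemma fpsC_is_monoid_morphism : monoid_morphism fpsC.
Proof.
split=> // a b; apply: fpsP => m.
have [->|nz_m] := eqVneq m 0%MM; first by rewrite fps_coefM0 !fps_coefC !eqxx.
rewrite fps_coefM fps_coefC (negPf nz_m) big1 // => l le_lm.
rewrite !fps_coefC; case: (eqVneq (l : 'X_{1..n}) 0%MM) => [->|_].
  by rewrite subm0 (negPf nz_m) mulr0.
by rewrite mul0r.
Qed.

HB.instance Definition _ :=
  GRing.isZmodMorphism.Build R {fps R[n]} fpsC fpsC_is_zmod_morphism.
HB.instance Definition _ :=
  GRing.isMonoidMorphism.Build R {fps R[n]} fpsC fpsC_is_monoid_morphism.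

(* The geometric series 1 + h + h^2 + ..., for h with zero constant term. *)
Definition fps_geom h : {fps R[n]} :=
  FPS (fun m => \sum_(s < (mdeg m).+1) fps_coef (h ^+ s) m).

Lemma fps_coefX_eq0 h s m :
  fps_coef h 0%MM = 0 -> (mdeg m < s)%N -> fps_coef (h ^+ s) m = 0.
Proof.
move=> h0; elim: s m => // s IH m lt_ms.
rewrite exprS fps_coefM big1 // => l le_lm.
have [->|nz_l] := eqVneq (l : 'X_{1..n}) 0%MM; first by rewrite h0 mul0r.
rewrite IH ?mulr0 // -ltnS (leq_trans _ lt_ms) // ltnS.
have e : (mdeg (m - l)%MM + mdeg l)%N = mdeg m by rewrite -mdegD submK.
by rewrite -[X in (_ < X)%N]e -addn1 leq_add2l lt0n mdeg_eq0.
Qed.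

Lemma fps_geomP h : fps_coef h 0%MM = 0 -> (1 - h) * fps_geom h = 1.
Proof.
move=> h0; apply: fpsP => m; set d := (mdeg m).+1.
transitivity (fps_coef ((1 - h) * \sum_(s < d) h ^+ s) m).
  rewrite !fps_coefM; apply: eq_bigr => l le_lm; congr (_ * _).
  rewrite fps_coef_sum /=.
  have le_d : ((mdeg (m - l)%MM).+1 <= d)%N by rewrite ltnS mdegB.
  rewrite (big_ord_widen _ (fun s => fps_coef (h ^+ s) (m - l)%MM) le_d).
  rewrite big_mkcond /=; apply: eq_bigr => s _.
  by case: ltnP => // lt_s; rewrite fps_coefX_eq0.
have -> : (1 - h) * \sum_(s < d) h ^+ s = 1 - h ^+ d.
  by rewrite -(opprB h 1) mulNr -subrX1 opprB.
by rewrite fps_coefB (fps_coefX_eq0 (s := d)) // subr0.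
Qed.

End FpsRing.

Section FpsUnitRing.
Variables (n : nat) (R : comUnitRingType).
Implicit Types f g : {fps R[n]}.

Definition fps_unit : pred {fps R[n]} :=
  fun f => fps_coef f 0%MM \is a GRing.unit.

Definition fps_inv f : {fps R[n]} :=
  if fps_unit f then
    let c := fpsC n (fps_coef f 0%MM)^-1 in c * fps_geom (1 - c * f)
  else f.

Lemma fps_mulVx : {in fps_unit, left_inverse 1 fps_inv *%R}.
Proof.
move=> f uf; have {}uf : fps_unit f := uf; rewrite /fps_inv uf.
set c := fpsC n _.
have h0 : fps_coef (1 - c * f) 0%MM = 0.
  by rewrite fps_coefB fps_coefM0 fps_coef1 fps_coefC !eqxx mulVr ?subrr.
by have := fps_geomP h0; rewrite opprB addrCA subrr addr0 mulrAC.
Qed.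

Lemma fps_unitPl f g : g * f = 1 -> fps_unit f.
Proof.
move=> /(congr1 (fun h => fps_coef h 0%MM)); rewrite fps_coefM0 fps_coef1 eqxx.
by move=> e; apply/unitrPr; exists (fps_coef g 0%MM); rewrite mulrC.
Qed.

Lemma fps_inv_out : {in [predC fps_unit], fps_inv =1 id}.
Proof. by move=> f nuf; have {nuf}/negPf : ~~ fps_unit f := nuf; rewrite /fps_inv => ->. Qed.

HB.instance Definition _ := GRing.ComNzRing_hasMulInverse.Build {fps R[n]}
  fps_mulVx fps_unitPl fps_inv_out.

End FpsUnitRing.

(** * Coinversion LLT polynomials *)

(* Partitions with [n] nonnegative parts. *)
Definition npartition (n : nat) : Type := {p : n.-tuple nat | sorted geq p}.

Definition mpartition (n k : nat) : Type := {ffun 'I_k -> npartition n}.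

HB.instance Definition _ (n k : nat) := Equality.on (mpartition n k).

(* All ordinal indices are 0-based: [r : 'I_n] stands for row r + 1,
   [a : 'I_k] for the shape with superscript a + 1, and an entry [i : 'I_n]
   of a tableau for i + 1. *)
Definition part (n k : nat) (la : mpartition n k) (a : 'I_k) (r : 'I_n) : nat :=
  tnth (val (la a)) r.

Section LLT.
Variables (n k : nat) (la : mpartition n k).

(* [Tagged _ c] over the index (a, r) is the cell in row r + 1 and
   column c + 1 of the a-th shape. *)
Definition cell : finType := {p : 'I_k * 'I_n & 'I_(part la p.1 p.2)}.

(* The possible positions of w in a triple (u, v, w): those of row r + 1 of
   the b-th shape, with 1 <= column <= (length of the row) + 1. *)
Definition xcell : finType := {p : 'I_k * 'I_n & 'I_(part la p.1 p.2).+1}.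

Definition row (u : cell) : nat := (tag u).2.+1.
Definition col (u : cell) : nat := (tagged u).+1.
Definition xrow (w : xcell) : nat := (tag w).2.+1.
Definition xcol (w : xcell) : nat := (tagged w).+1.

Definition content (u : cell) : int := (col u)%:Z - (row u)%:Z.
Definition xcontent (w : xcell) : int := (xcol w)%:Z - (xrow w)%:Z.

Definition filling : finType := {ffun cell -> 'I_n}.
Implicit Type T : filling.

Definition is_tableau T : bool :=
  [forall u : cell, forall v : cell, ((tag u).1 == (tag v).1) ==>
    ((row u == row v) && (col u <= col v)%N ==> (T u <= T v)%N) &&
    ((col u == col v) && (row u < row v)%N ==> (T u < T v)%N)].

(* The entry in [1, n] of [T] at column [c] (counted from 1) of the row
   p = (b, r), or [None] if that position is not a cell of the shape. *)
Definition entry T (p : 'I_k * 'I_n) (c : nat) : option nat :=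
  if c is c'.+1 then
    omap (fun j : 'I_(part la p.1 p.2) =>
            (T (Tagged (fun q : 'I_k * 'I_n => 'I_(part la q.1 q.2)) j)).+1 : nat)
         (insub c')
  else None.

(* The triple (u, v, w), where u is the position immediately left of w; a
   missing u has entry 0 and a missing w has entry infinity. *)
Definition is_triple (v : cell) (w : xcell) : bool :=
  ((tag v).1 < (tag w).1)%N && (xcontent w == content v).

Definition is_coinversion T (v : cell) (w : xcell) : bool :=
  (odflt 0 (entry T (tag w) (xcol w).-1) <= (T v).+1)%N &&
  (if entry T (tag w) (xcol w) is Some e then ((T v).+1 <= e)%N else true).

Definition coinv T : nat :=
  #|[set q : cell * xcell | is_triple q.1 q.2 && is_coinversion T q.1 q.2]|.

(* The coinversion LLT polynomial of [la], evaluated at the variables [x]. *)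
Definition LLT (A : comNzRingType) (x : 'I_n -> A) (t : A) : A :=
  \sum_(T : filling | is_tableau T) t ^+ coinv T * \prod_(u : cell) x (T u).

Definition dstat : int :=
  ('C(n, 2) * 'C(k, 2))%N%:Z -
  #|[set q : ('I_n * 'I_n) * ('I_k * 'I_k) |
      let: ((i, j), (a, b)) := q in
      (a < b)%N &&
      ((part la b i)%:Z - i.+1%:Z < (part la a j)%:Z - j.+1%:Z)]|%:Z.

End LLT.

(* Main.v *)
(** A [k]-tuple of partitions with [n] parts is a configuration of coloured
particles on a half-line: row [r] of the shape of colour [c] puts a particle of
colour [c] at site [lambda_r - r + n]. Adding the cells with a given entry moves
the particles to the right along interlacing paths, and a coinversion triple is a
path of colour [a] crossing a bond whose left end is visited by a particle of
colour [b > a]. Hence the LLT polynomial is a sum over chains of configurations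
of products of one-variable row weights. Conjugating the row weight by
[t^(- number of inversions)] exchanges the roles of [a] and [b] in the statistic,
and this absorbs [t^d] into the second LLT polynomial.

Everything then follows from a commutation relation: for fixed [mu] and [nu],
[prod_m (1 - x y t^m)] times the sum over [lambda] of the weights of [mu -> lambda]
(variable [x]) and [nu -> lambda] (variable [y]) equals the sum over [kappa] of the
weights of [kappa -> nu] and [kappa -> mu]. Both sums are scanned from left to
right, one colour of one site at a time; the vectors of partial sums are related
by an explicit matrix, and intertwining at a single step is the two-term identity
[z t^c + (1 - z t^c) = 1], with [z = x y]. *)

Require Import Defs.
From mathcomp Require Import all_boot all_order all_algebra.
From mathcomp Require Import mpoly boolp.
From mathcomp Require Import ring zify.

Set Implicit Arguments.
Unset Strict Implicit.
Unset Printing Implicit Defensive.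

Import GRing.Theory.
Local Open Scope ring_scope.

(** * Sums over words *)

(** The commutation relation is used to show that the vector [chain weight2 j], obtained from the
    packed configuration by [j] rows in the variables [y], is an eigenvector of the row operator in
    [x], up to an error. Each induction step moves the [x]-row past one [y]-row and releases one
    factor of the product; when no [y]-row is left, the [x]-row meets the packed configuration, on
    which it acts trivially. Two obstacles shape the details. The two scans need matching initial
    values, which is ensured by site 0 being full in both [mu] and [nu]; a row empties at most one
    more site of the packed block per colour, so site 0 stays full as long as fewer than [n] rows
    have been applied. Moreover the half-line is cut to [S] sites to keep all sums finite; paths can
    then run off the end, and the relations hold modulo terms of degree at least [S - n]. For a
    coefficient of degree [d], [S = n + d + 1] suffices. *)

Section Transfer.
Variables (A : comNzRingType) (X : finType) (S : Type).
Variables (dl : nat -> S -> X -> S) (M : nat -> S -> X -> A) (s0 : S).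

(** The recursion peels off the last letter and pulls the test function [F] back through it. In this
    form an intertwiner used as test function can be exchanged one letter at a time. *)
Fixpoint transfer T (F : S -> A) : A :=
  if T is T'.+1 then transfer T' (fun s => \sum_b M T' s b * F (dl T' s b))
  else F s0.

Fixpoint run (f : nat -> X) i : S :=
  if i is j.+1 then dl j (run f j) (f j) else s0.

Lemma eq_run f g i : (forall j, (j < i)%N -> f j = g j) -> run f i = run g i.
Proof.
elim: i => //= i IH fg; rewrite fg // IH // => j ji.
by apply: fg; exact: ltnW.
Qed.

Lemma eq_transfer T F G : (forall s, F s = G s) -> transfer T F = transfer T G.
Proof.
elim: T F G => /= [|T IH] F G FG //.
by apply: IH => s; apply: eq_bigr => b _; rewrite FG.
Qed.

Lemma transferE (x0 : X) T F : transfer T F =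
  \sum_(w : T.-tuple X)
    (\prod_(i < T) M i (run (nth x0 w) i) (nth x0 w i)) * F (run (nth x0 w) T).
Proof.
elim: T F => [|T IH] F /=.
  rewrite (big_pred1 [tuple]) ?big_ord0 ?mul1r // => w.
  by rewrite [w]tuple0; apply/esym/eqP.
rewrite IH.
rewrite (reindex (fun q : T.-tuple X * X => [tuple of rcons q.1 q.2])) /=; last first.
  exists (fun w : T.+1.-tuple X =>
            (([tuple of belast (thead w) (behead w)] : T.-tuple X),
             last (thead w) (behead w))) => [[w b] _|w _].
    congr pair; last first.
      by case: w => [[|a s] sz] //=; rewrite last_rcons.
    by apply: val_inj; case: w => [[|a s] sz] //=; rewrite belast_rcons.
  by apply: val_inj => /=; case/tupleP: w => a s /=; rewrite -lastI theadE.
rewrite -(pair_bigA _ (fun (w : T.-tuple X) b => 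
   (\prod_(i < T.+1) M i (run (nth x0 (rcons w b)) i) (nth x0 (rcons w b) i)) *
   F (dl T (run (nth x0 (rcons w b)) T) (nth x0 (rcons w b) T)))) /=.
apply: eq_bigr => w _; rewrite big_distrr /=; apply: eq_bigr => b _.
have nthE j : (j < T)%N -> nth x0 (rcons w b) j = nth x0 w j.
  by move=> jT; rewrite nth_rcons size_tuple jT.
have runE i : (i <= T)%N -> run (nth x0 (rcons w b)) i = run (nth x0 w) i.
  by move=> iT; apply: eq_run => j ji; apply: nthE; exact: leq_trans ji iT.
rewrite big_ord_recr /= runE // nth_rcons size_tuple ltnn eqxx.
rewrite -!mulrA; congr (_ * _); apply: eq_bigr => i _.
by rewrite runE ?nthE // ltnW.
Qed.
End Transfer.

(** * The identity for a single colour *)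

Section Local.
Variables (A : comNzRingType) (x y t : A).

(** The bits [p, q] and [p', q'] are the flight bits of the current colour in the lambda-state and
    in the kappa-state, [m] and [e] its occupation numbers in mu and nu; [al, be, al', be'] collect
    the other colours. [G] is the product in the intertwiner, with one factor more when the current
    colour has defect 0. All 64 bit patterns reduce to ring identities, the two-term cancellation
    among them. *)
Lemma local_bits (al be al' be' : nat) (G0 G1 : A) (p q m e p' q' : bool) :
  G1 = G0 * (1 - x * y * t ^+ (al + be + (al' + be'))) ->
  let G (b : bool) := if b then G1 else G0 in
  \sum_(b : bool)
   (if [&& ~~ (p && m), ~~ (q && e), b ==> p || m & b ==> q || e] then
     let p1 := (p || m) && ~~ b in let q1 := (q || e) && ~~ b in
     x ^+ p1 * y ^+ q1 * t ^+ ((p || m) * al + (q || e) * be) *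
     (if ((p' + q1 == q' + p1) && (p' + q1 <= 1))%N then
       t ^+ (q1 * (al + al') + p1 * (be + be')) * G (p' + q1 == 0)%N else 0) else 0)
  = \sum_(b : bool)
   (if [&& b ==> p', b ==> q', ~~ (p' && ~~ b && e) & ~~ (q' && ~~ b && m)] then
     let p1 := p' && ~~ b in let q1 := q' && ~~ b in
     let ps := p1 || e in let qs := q1 || m in
     x ^+ p1 * y ^+ q1 * t ^+ (p1 * be' + q1 * al') *
     (if ((ps + q == qs + p) && (ps + q <= 1))%N then
       t ^+ ((ps + q) * (al + be)) * G (ps + q == 0)%N else 0) else 0).
Proof.
move=> -> /=; rewrite !big_bool /=.
case: p; case: q; case: m; case: e; case: p'; case: q' => //=;
rewrite ?(mul0n, mul1n, addn0, add0n, exprD, expr0, expr1) /=; try ring.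
Qed.
End Local.

(** * The local exchange relation *)

Section Exchange.
(* There are [k.+1] colours. *)
Variable k : nat.
Local Notation K := 'I_k.+1.
Local Notation st := {ffun K -> bool}.
Implicit Types (P Q : st) (c o : K).

Definition upd P c (v : bool) : st := [ffun o => if o == c then v else P o].
Definition lo c P : nat := (\sum_(a : K | a < c) P a)%N.
Definition hi c P : nat := (\sum_(b : K | c < b) P b)%N.

Lemma upd_eq P c v : upd P c v c = v. Proof. by rewrite ffunE eqxx. Qed.
Lemma upd_neq P c v o : o != c -> upd P c v o = P o.
Proof. by rewrite ffunE => /negPf ->. Qed.

Lemma sum_pair_split (f : K -> K -> nat) c :
  (\sum_(a : K) \sum_(b : K | a < b) f a b =
   \sum_(a : K | a != c) \sum_(b : K | (a < b) && (b != c)) f a b +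
   (\sum_(a : K | a < c) f a c + \sum_(b : K | c < b) f c b))%N.
Proof.
rewrite (bigD1 c) //= addnC addnA; congr (_ + _)%N.
rewrite [X in (_ + X)%N]big_mkcond [X in (_ + X)%N](bigD1 c) //= ltnn add0n.
rewrite -big_split /=; apply: eq_bigr => a ac.
case: ifP => lt_ac; last first.
  by rewrite addn0; apply: eq_bigl => b; case: (eqVneq b c) => [->|]; rewrite ?lt_ac ?andbT.
by rewrite (bigD1 c) //= addnC.
Qed.

Variables (A : comNzRingType) (x y t : A).

(* A state is a pair of sets of colours: the colours whose path in the row of
   variable [x], resp. [y], is in flight. For a state [s] of the lambda-scan and
   a state [s'] of the kappa-scan, [defect s s' o] is the number of particles of
   colour [o] read so far in kappa minus the number read in lambda; the
   intertwiner [Rmat] is supported on the pairs whose defects all lie in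
   {0, 1}. *)
Definition defect (s s' : st * st) o : nat := (s'.1 o + s.2 o)%N.

Definition compat_at (s s' : st * st) o : bool :=
  (s'.1 o + s.2 o == s'.2 o + s.1 o)%N && (s'.1 o + s.2 o <= 1)%N.

(* [c] is the number of colours already processed at the current site; the
   pairs of colours with only one processed member carry another exponent. *)
Definition rho (c : nat) (s s' : st * st) : nat :=
  (\sum_(a : K) \sum_(b : K | a < b)
     if a < c <= b then defect s s' b * s.1 a else defect s s' a * s.2 b)%N.

(** There is one factor for each colour of defect 0. The exponents descend from [k], so that [k.+1]
    such colours give the whole Cauchy product of one pair of variables. *)
Definition qfact (j : nat) : A := \prod_(i < j) (1 - x * y * t ^+ (k - i)).

Definition Rmat (c : nat) (s s' : st * st) : A :=
  if [forall o, compat_at s s' o] then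
    t ^+ rho c s s' * qfact (\sum_o (defect s s' o == 0))%N
  else 0.

(* Processing colour [c] at a site where mu, nu and lambda have the occupation
   numbers [m], [e] and [b]. *)
Definition stepL c (s : st * st) (m e b : bool) : st * st :=
  (upd s.1 c ((s.1 c || m) && ~~ b), upd s.2 c ((s.2 c || e) && ~~ b)).

Definition wtL c (s : st * st) (m e b : bool) : A :=
  if [&& ~~ (s.1 c && m), ~~ (s.2 c && e), b ==> s.1 c || m & b ==> s.2 c || e]
  then x ^+ ((s.1 c || m) && ~~ b) * y ^+ ((s.2 c || e) && ~~ b) *
       t ^+ ((s.1 c || m) * lo c s.1 + (s.2 c || e) * hi c s.2)
  else 0.

(* The state before the step is recovered from the state [s] after it: here [b]
   is the occupation number of kappa at the next site. *)
Definition unstepK c (s : st * st) (m e b : bool) : st * st :=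
  (upd s.1 c (s.1 c && ~~ b || e), upd s.2 c (s.2 c && ~~ b || m)).

Definition wtK c (s : st * st) (m e b : bool) : A :=
  if [&& b ==> s.1 c, b ==> s.2 c, ~~ (s.1 c && ~~ b && e)
       & ~~ (s.2 c && ~~ b && m)]
  then x ^+ (s.1 c && ~~ b) * y ^+ (s.2 c && ~~ b) *
       t ^+ ((s.1 c && ~~ b) * hi c s.1 + (s.2 c && ~~ b) * lo c s.2)
  else 0.

Lemma lo_upd c P v : lo c (upd P c v) = lo c P.
Proof.
apply: eq_bigr => o oc; rewrite upd_neq //.
by apply: contraTneq oc => ->; rewrite ltnn.
Qed.

Lemma hi_upd c P v : hi c (upd P c v) = hi c P.
Proof.
apply: eq_bigr => o oc; rewrite upd_neq //.
by apply: contraTneq oc => ->; rewrite ltnn.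
Qed.

Definition compat_off c (s s' : st * st) : bool :=
  [forall o, (o != c) ==> compat_at s s' o].
Definition rho_off c (s s' : st * st) : nat :=
  (\sum_(a : K | a != c) \sum_(b : K | (a < b) && (b != c))
     if a < c <= b then defect s s' b * s.1 a else defect s s' a * s.2 b)%N.
Definition zeros_off c (s s' : st * st) : nat :=
  (\sum_(o | o != c) (defect s s' o == 0))%N.

Lemma compat_split c s s' :
  [forall o, compat_at s s' o] = compat_off c s s' && compat_at s s' c.
Proof.
apply/forallP/andP => [h|[/forallP h1 h2] o].
  by split=> //; apply/forallP => o; rewrite h implybT.
by have [->|oc] := eqVneq o c => //; have := h1 o; rewrite oc.
Qed.

Lemma zeros_split c s s' :
  (\sum_o (defect s s' o == 0) = zeros_off c s s' + (defect s s' c == 0))%N.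
Proof. by rewrite (bigD1 c) //= addnC. Qed.

(** Before the step, the pairs containing [c] are all weighted by the defect of [c] itself. *)
Lemma rho_pre c s s' :
  (rho c s s' = rho_off c s s' + defect s s' c * (lo c s.1 + hi c s.2))%N.
Proof.
rewrite /rho (sum_pair_split _ c); congr (_ + _)%N.
rewrite mulnDr !big_distrr /=; congr (_ + _)%N.
  by apply: eq_bigr => a ac; rewrite ac leqnn.
by apply: eq_bigr => b cb; rewrite ltnn.
Qed.

(** After the step, the pairs containing [c] carry the defect of the other colour. For a colour
    below [c], compatibility rewrites that defect as the sum of its bits in [s.1] and [s'.2], whence
    the [lo] counts. *)
Lemma rho_post c s s' : compat_off c s s' ->
  (rho c.+1 s s' = rho_off c s s' +
     (s.2 c * (lo c s.1 + lo c s'.2) + s.1 c * (hi c s.2 + hi c s'.1)))%N.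
Proof.
move=> /forallP ok; rewrite /rho (sum_pair_split _ c); congr (_ + _)%N.
  apply: eq_bigr => a ac; apply: eq_bigr => b /andP[ab bc].
  suff -> : (a < c.+1 <= b)%N = (a < c <= b)%N by [].
  have := ac; have := bc; rewrite -!val_eqE /=; lia.
rewrite /lo /hi -!big_split !big_distrr /=; congr (_ + _)%N.
  apply: eq_bigr => a ac; rewrite ltnn andbF mulnC; congr (_ * _)%N.
  have ac' : a != c by apply: contraTneq ac => ->; rewrite ltnn.
  have := ok a; rewrite /defect ac' /= => /andP[/eqP-> _].
  by rewrite addnC.
apply: eq_bigr => b cb; rewrite ltnS leqnn cb /= mulnC /defect.
by congr (_ * _)%N; rewrite addnC.
Qed.

(** Compatible defects are 0 or 1, so the left side is the sum of the defects of the colours other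
    than [c]; below [c] the defect is read through its second expression. This matches the exponent
    of the next factor of [qfact] with the exponent in [local_bits]. *)
Lemma zeros_offE c s s' : compat_off c s s' ->
  (k - zeros_off c s s' = lo c s.1 + hi c s.2 + (lo c s'.2 + hi c s'.1))%N.
Proof.
move=> /forallP ok.
have kE : (\sum_(o : K | o != c) 1 = k)%N by rewrite sum1_card cardC1 card_ord.
rewrite -[X in (X - _)%N]kE.
have -> : (lo c s.1 + hi c s.2 + (lo c s'.2 + hi c s'.1) =
   \sum_(o | o != c) defect s s' o)%N.
  rewrite (bigID (fun o : K => (o < c)%N)) /=.
  have -> : (\sum_(i < k.+1 | (i != c) && (i < c)) defect s s' i =
     lo c s.1 + lo c s'.2)%N.
    rewrite /lo -big_split /=; apply: eq_big => o.
      by rewrite -val_eqE /=; lia.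
    by move=> /andP[oc _]; have := ok o; rewrite /defect oc /= => /andP[/eqP-> _]; rewrite addnC.
  have -> : (\sum_(i < k.+1 | (i != c) && ~~ (i < c)) defect s s' i =
     hi c s.2 + hi c s'.1)%N.
    rewrite /hi -big_split /=; apply: eq_big => o.
      by rewrite -val_eqE /=; lia.
    by rewrite addnC.
  lia.
rewrite -sumnB /=; last by move=> o _; case: (_ == _).
apply: eq_bigr => o oc; have := ok o; rewrite oc /= => /andP[_].
by rewrite /defect; case: (s'.1 o); case: (s.2 o).
Qed.

Lemma eq_off c (s1 s1' s2 s2' : st * st) :
  (forall o, o != c -> s1.1 o = s2.1 o) -> (forall o, o != c -> s1.2 o = s2.2 o) ->
  (forall o, o != c -> s1'.1 o = s2'.1 o) -> (forall o, o != c -> s1'.2 o = s2'.2 o) ->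
  [/\ compat_off c s1 s1' = compat_off c s2 s2', rho_off c s1 s1' = rho_off c s2 s2'
    & zeros_off c s1 s1' = zeros_off c s2 s2'].
Proof.
move=> e1 e2 e3 e4.
have eD o : o != c -> defect s1 s1' o = defect s2 s2' o.
  by move=> oc; rewrite /defect e3 ?e2.
split.
- apply: eq_forallb => o; case oc: (o != c) => //=.
  by rewrite /compat_at e1 ?e2 ?e3 ?e4.
- apply: eq_bigr => a ac; apply: eq_bigr => b /andP[_ bc].
  by rewrite !eD ?e1 ?e2.
- by apply: eq_bigr => o oc; rewrite eD.
Qed.

Lemma qfactS j : qfact j.+1 = qfact j * (1 - x * y * t ^+ (k - j)).
Proof. by rewrite /qfact big_ord_recr. Qed.

(** A step changes the states at [c] alone, so the part of the intertwiner that avoids [c] is common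
    to both sides. Once it is factored out, [local_bits] remains. *)
Lemma exchange_local c s s' (m e : bool) :
  \sum_(b : bool) wtL c s m e b * Rmat c.+1 (stepL c s m e b) s' =
  \sum_(b : bool) wtK c s' m e b * Rmat c s (unstepK c s' m e b).
Proof.
have offL b : [/\ compat_off c (stepL c s m e b) s' = compat_off c s s',
    rho_off c (stepL c s m e b) s' = rho_off c s s'
    & zeros_off c (stepL c s m e b) s' = zeros_off c s s'].
  by apply: eq_off => o oc //=; rewrite upd_neq.
have offK b : [/\ compat_off c s (unstepK c s' m e b) = compat_off c s s',
    rho_off c s (unstepK c s' m e b) = rho_off c s s'
    & zeros_off c s (unstepK c s' m e b) = zeros_off c s s'].
  by apply: eq_off => o oc //=; rewrite upd_neq.
case ok: (compat_off c s s'); last first.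
  rewrite [LHS]big1 => [|b _]; last first.
    by rewrite /Rmat (compat_split c); have [-> _ _] := offL b; rewrite ok mulr0.
  rewrite big1 // => b _; rewrite /Rmat (compat_split c).
  by have [-> _ _] := offK b; rewrite ok mulr0.
pose z0 := zeros_off c s s'.
have := @local_bits A x y t (lo c s.1) (hi c s.2) (lo c s'.2) (hi c s'.1)
  (qfact z0) (qfact z0.+1) (s.1 c) (s.2 c) m e (s'.1 c) (s'.2 c).
rewrite qfactS -(zeros_offE ok) => /(_ erefl) /= /(congr1 (fun z => t ^+ rho_off c s s' * z)).
rewrite [X in X = _ -> _]mulr_sumr [X in _ = X -> _]mulr_sumr => eqn.
move: eqn; congr (_ = _); apply: eq_bigr => b _.
- rewrite /wtL; case: ifP => _; last by rewrite mulr0 mul0r.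
  have [okb rb zb] := offL b.
  rewrite /Rmat (compat_split c) okb ok /=; rewrite /compat_at /= !upd_eq.
  case: ifP => _; last by rewrite !mulr0.
  rewrite rho_post ?okb // rb (zeros_split c) zb /= !upd_eq.
  rewrite lo_upd hi_upd.
  rewrite /defect /= upd_eq -/z0 mulrCA; congr (_ * _); rewrite mulrA -exprD; congr (_ * _).
  by case: ifP => _; rewrite ?addn1 ?addn0 ?qfactS.
- rewrite /wtK; case: ifP => _; last by rewrite mulr0 mul0r.
  have [okb rb zb] := offK b.
  rewrite /Rmat (compat_split c) okb ok /=; rewrite /compat_at /= !upd_eq.
  case: ifP => _; last by rewrite !mulr0.
  rewrite rho_pre rb (zeros_split c) zb.
  rewrite /defect /= upd_eq -/z0 mulrCA; congr (_ * _); rewrite mulrA -exprD; congr (_ * _).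
  by case: ifP => _; rewrite ?addn1 ?addn0 ?qfactS.
Qed.

End Exchange.

Lemma big_ord_mul (R : Type) (idx : R) (op : Monoid.law idx) (S n : nat)
    (F : nat -> R) :
  \big[op/idx]_(i < S * n) F i =
  \big[op/idx]_(s < S) \big[op/idx]_(c < n) F (s * n + c)%N.
Proof.
elim: S => [|S IH]; first by rewrite mul0n !big_ord0.
rewrite big_ord_recr /= -IH -!(big_mkord xpredT F) mulSnr.
rewrite (@big_cat_nat _ _ _ (S * n)) ?leq_addr //=; congr (op _ _).
by rewrite -{1}(add0n (S * n)%N) big_addn addKn big_mkord; apply: eq_bigr => i _; rewrite addnC.
Qed.

Lemma if_and4 (A : comNzRingType) (a b c d : bool) (u v : A) :
  (if [&& a, b, c & d] then u * v else 0) =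
  (if a && c then u else 0) * (if b && d then v else 0).
Proof. by case: a; case: b; case: c; case: d; rewrite /= ?mulr0 ?mul0r. Qed.

(** * Rows of particle paths *)

Section Rows.
Variable k : nat.
Local Notation K := 'I_k.+1.
Local Notation st := {ffun K -> bool}.
Local Notation bits := (nat -> K -> bool).
Implicit Types (P Q : st) (B C : bits).

Definition st0 : st := [ffun=> false].

(* [edge B C s c]: in the row with bottom configuration [B] and top configuration
   [C], a path of colour [c] crosses the bond from site [s - 1] to site [s].
   [pres B C s c]: a particle of colour [c] visits site [s]. *)
Fixpoint edge B C s : st :=
  if s is s'.+1 then [ffun c => (edge B C s' c || B s' c) && ~~ C s' c]
  else st0.

Definition pres B C s : st := [ffun c => edge B C s c || B s c].
Definition presS B C s : st := if s is s'.+1 then pres B C s' else st0.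
Definition shift B s : K -> bool := if s is s'.+1 then B s' else fun=> false.

(** The state in the middle of a site, after [c] of its colours have been processed. *)
Definition mix (c : nat) P' P : st := [ffun o : K => if (o < c)%N then P' o else P o].

Lemma edgeS B C s c : edge B C s.+1 c = pres B C s c && ~~ C s c.
Proof. by rewrite /= !ffunE. Qed.

Lemma edge_shift B C s c : edge B C s c = presS B C s c && ~~ shift C s c.
Proof. by case: s => [|s]; rewrite ?edgeS // ?ffunE. Qed.

Lemma mix0 P' P : mix 0 P' P = P.
Proof. by apply/ffunP => o; rewrite ffunE. Qed.
Lemma mixk P' P : mix k.+1 P' P = P'.
Proof. by apply/ffunP => o; rewrite ffunE ltn_ord. Qed.
Lemma mix_at (c : K) P' P : mix c P' P c = P c.
Proof. by rewrite ffunE ltnn. Qed.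
Lemma lo_mix (c : K) P' P : lo c (mix c P' P) = lo c P'.
Proof. by apply: eq_bigr => o oc; rewrite ffunE oc. Qed.
Lemma hi_mix (c : K) P' P : hi c (mix c P' P) = hi c P.
Proof. by apply: eq_bigr => o oc; rewrite ffunE ltnNge ltnW. Qed.
Lemma upd_mix (c : K) P' P v : v = P' c -> upd (mix c P' P) c v = mix c.+1 P' P.
Proof.
move=> ->; apply/ffunP => o; rewrite !ffunE ltnS.
have [->|oc] := eqVneq o c; first by rewrite leqnn.
by rewrite ltn_neqAle (_ : (o : nat) != c).
Qed.

Definition colour (i : nat) : K := inord (i %% k.+1).
Definition flat B (i : nat) : bool := B (i %/ k.+1)%N (colour i).
Definition unflat (f : nat -> bool) : bits := fun s c => f (s * k.+1 + c)%N.

Lemma colourE s (c : K) : colour (s * k.+1 + c) = c.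
Proof. by apply/val_inj; rewrite /= inordK ?modnMDl ?modn_small // ltn_pmod. Qed.
Lemma flatE B s (c : K) : flat B (s * k.+1 + c) = B s c.
Proof. by rewrite /flat colourE divnMDl // divn_small // addn0. Qed.

Lemma run_sites (St : Type) (dl : nat -> St -> bool -> St) (s0 : St)
    (f : nat -> bool) (g : nat -> nat -> St) :
  g 0 0 = s0 -> (forall s, g s.+1 0 = g s k.+1) ->
  (forall s (c : K), dl (s * k.+1 + c)%N (g s c) (f (s * k.+1 + c)%N) = g s c.+1) ->
  forall s c, (c <= k.+1)%N -> run dl s0 f (s * k.+1 + c) = g s c.
Proof.
move=> g0 gS gstep.
have runS i : run dl s0 f i.+1 = dl i (run dl s0 f i) (f i) by [].
elim=> [|s IHs].
  by elim=> [|c IHc] ck //; rewrite mul0n add0n runS -(gstep 0%N (Ordinal ck)) -IHc //= ltnW.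
elim=> [|c IHc] ck; first by rewrite addn0 mulSnr IHs // gS.
by rewrite addnS runS IHc ?(ltnW ck) // (gstep s.+1 (Ordinal ck)).
Qed.

Variables (A : comNzRingType) (t : A).

(** Interlacing in local form: a path does not enter a site where another path of its colour starts,
    and every top particle is the end of a path. *)
Definition sound B C s c : bool :=
  ~~ (edge B C s c && B s c) && (C s c ==> pres B C s c).

(* The pairs of colours a < b counted are those with the [a]-path leaving a site
   visited by [b] in [raw1], and with the [b]-path entering a site visited by [a]
   in [raw2]. *)
Definition raw1 z B C S : A :=
  \prod_(s < S) \prod_(c : K)
    if sound B C s c then z ^+ edge B C s.+1 c * t ^+ (pres B C s c * lo c (edge B C s.+1))
    else 0.
Definition raw2 z B C S : A :=
  \prod_(s < S) \prod_(c : K)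
    if sound B C s c then z ^+ edge B C s.+1 c * t ^+ (pres B C s c * hi c (edge B C s))
    else 0.

Definition is_closed B C S : bool := edge B C S == st0.

Definition row1 z B C S : A := raw1 z B C S * (is_closed B C S)%:R.
Definition row2 z B C S : A := raw2 z B C S * (is_closed B C S)%:R.

Variables (x y : A) (mu nu : bits).

Definition scanL_step (i : nat) (s : st * st) b :=
  stepL (colour i) s (flat mu i) (flat nu i) b.
Definition scanL_wt (i : nat) (s : st * st) b :=
  wtL x y t (colour i) s (flat mu i) (flat nu i) b.
Definition scanL := transfer scanL_step scanL_wt (st0, st0).

Lemma run_scanL f s c : (c <= k.+1)%N ->
  run scanL_step (st0, st0) f (s * k.+1 + c) =
  (mix c (edge mu (unflat f) s.+1) (edge mu (unflat f) s),
   mix c (edge nu (unflat f) s.+1) (edge nu (unflat f) s)).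
Proof.
apply: (run_sites (g := fun s c =>
  (mix c (edge mu (unflat f) s.+1) (edge mu (unflat f) s),
   mix c (edge nu (unflat f) s.+1) (edge nu (unflat f) s)))).
- by rewrite !mix0.
- by move=> s'; rewrite !mix0 !mixk.
move=> s' c'; rewrite /scanL_step /stepL colourE !flatE /= !mix_at.
by congr pair; apply: upd_mix; rewrite ffunE.
Qed.

Lemma scanLE S F : scanL (S * k.+1) F =
  \sum_(w : (S * k.+1).-tuple bool)
    let C := unflat (nth false w) in
    raw1 x mu C S * raw2 y nu C S * F (edge mu C S, edge nu C S).
Proof.
rewrite /scanL (transferE _ _ _ false); apply: eq_bigr => w _ /=.
set f := nth false w; set C := unflat f.
have := @run_scanL f S 0 isT; rewrite addn0 !mix0 => ->; congr (_ * _).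
rewrite (big_ord_mul _ _ _ (fun i => scanL_wt i (run scanL_step (st0, st0) f i) (f i))).
rewrite -big_split; apply: eq_bigr => s _; rewrite -big_split; apply: eq_bigr => c _ /=.
rewrite (run_scanL _ _ (ltnW (ltn_ord c))) /scanL_wt /wtL colourE !flatE /= !mix_at lo_mix hi_mix -/C.
rewrite -[f _]/(C s c) exprD mulrACA if_and4.
by rewrite /sound !ffunE.
Qed.
End Rows.

Section TransferLinear.
Variables (A : comNzRingType) (X : finType) (S : Type).
Variables (dl : nat -> S -> X -> S) (M : nat -> S -> X -> A) (s0 : S).

Lemma transfer_sum (I : finType) (c : I -> A) (G : I -> S -> A) T :
  transfer dl M s0 T (fun s => \sum_i c i * G i s) =
  \sum_i c i * transfer dl M s0 T (G i).
Proof.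
elim: T G => //= T IH G; rewrite -IH; apply: eq_transfer => s.
under eq_bigr do rewrite big_distrr.
rewrite exchange_big /=; apply: eq_bigr => i _.
by rewrite big_distrr; apply: eq_bigr => b _ /=; rewrite mulrCA.
Qed.
End TransferLinear.

(** * The scan over the lower configuration kappa *)

Section ScanK.
Variable k : nat.
Local Notation K := 'I_k.+1.
Local Notation st := {ffun K -> bool}.
Local Notation bits := (nat -> K -> bool).
Implicit Types (P Q : st) (B C : bits).
Variables (A : comNzRingType) (t x y : A) (mu nu : bits).

Definition stepK (c : K) (s : st * st) (m e b : bool) : st * st :=
  (upd s.1 c (s.1 c && ~~ e || b), upd s.2 c (s.2 c && ~~ m || b)).

Definition wtKf (c : K) (s : st * st) (m e b : bool) : A :=
  if [&& e ==> s.1 c, m ==> s.2 c, ~~ (s.1 c && ~~ e && b) & ~~ (s.2 c && ~~ m && b)]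
  then x ^+ (s.1 c && ~~ e) * y ^+ (s.2 c && ~~ m) *
       t ^+ ((s.1 c && ~~ e) * hi c s.1 + (s.2 c && ~~ m) * lo c s.2)
  else 0.

Lemma eq_upd (P P' : st) c v v' : P' c = v' ->
  (upd P c v == P') = (v == v') && (P == upd P' c (P c)).
Proof.
move=> <-; apply/eqP/andP => [<-|[/eqP-> /eqP->]].
  split; rewrite ?upd_eq //; apply/eqP/ffunP => o; rewrite !ffunE.
  by case: eqVneq => [->|].
by apply/ffunP => o; rewrite !ffunE; case: eqVneq => [->|].
Qed.

Lemma eq_upd' (P P' : st) c v : (P == upd P' c v) = (P c == v) && (P == upd P' c (P c)).
Proof.
apply/eqP/andP => [->|[/eqP<- /eqP] //].
by rewrite upd_eq.
Qed.

(** Both sides are the matrix entry of one step from [s] to [s'] with letter [b]: read forwards, [s]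
    determines [s']; read backwards, [s'] determines [s]. This turns the scan over kappa into the
    backward recursion that [exchange_local] produces. *)
Lemma stepK_inv c s s' m e b :
  wtKf c s m e b * (stepK c s m e b == s')%:R =
  wtK x y t c s' m e b * (s == unstepK c s' m e b)%:R.
Proof.
case: s s' => [P Q] [P' Q']; rewrite /wtKf /stepK /wtK /unstepK /= !xpair_eqE.
rewrite (eq_upd P _ (erefl (P' c))) (eq_upd Q _ (erefl (Q' c))).
rewrite [P == upd _ _ (_ || _)]eq_upd' [Q == upd _ _ (_ || _)]eq_upd'.
case: (P =P upd P' c (P c)) => eP; last by rewrite !andbF !mulr0.
case: (Q =P upd Q' c (Q c)) => eQ; last by rewrite !andbF !mulr0.
have hP : hi c P = hi c P' by rewrite eP hi_upd.
have hQ : lo c Q = lo c Q' by rewrite eQ lo_upd.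
rewrite hP hQ !andbT.
by case: (P c); case: (Q c); case: (P' c); case: (Q' c); case: m; case: e; case: b;
  rewrite /= ?mulr0 ?mul0r.
Qed.

(* The kappa-scan runs one site ahead: while it reads site [s] of kappa, it
   removes the particles of mu and nu at site [s - 1], so that its states record
   visited sites instead of crossed bonds. *)
Definition scanK_step (i : nat) (s : st * st) b :=
  stepK (colour k i) s (shift mu (i %/ k.+1) (colour k i))
                    (shift nu (i %/ k.+1) (colour k i)) b.
Definition scanK_wt (i : nat) (s : st * st) b :=
  wtKf (colour k i) s (shift mu (i %/ k.+1) (colour k i))
                    (shift nu (i %/ k.+1) (colour k i)) b.
Definition scanK := transfer scanK_step scanK_wt (st0 k, st0 k).
Definition scanK_at i s' := scanK i (fun s => (s == s')%:R).

Lemma scanK_atS i s' : scanK_at i.+1 s' =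
  \sum_(b : bool)
    wtK x y t (colour k i) s' (shift mu (i %/ k.+1) (colour k i))
       (shift nu (i %/ k.+1) (colour k i)) b *
    scanK_at i (unstepK (colour k i) s' (shift mu (i %/ k.+1) (colour k i))
       (shift nu (i %/ k.+1) (colour k i)) b).
Proof.
rewrite /scanK_at /scanK -transfer_sum /=; apply: eq_transfer => s.
by apply: eq_bigr => b _; apply: stepK_inv.
Qed.

(** The additional [k.+1] letters compensate for the look-ahead by one site: the particles removed
    are then those of mu and nu at position [i] itself. *)
Lemma scanK_atD i s' : scanK_at (i + k.+1).+1 s' =
  \sum_(b : bool)
    wtK x y t (colour k i) s' (flat mu i) (flat nu i) b *
    scanK_at (i + k.+1) (unstepK (colour k i) s' (flat mu i) (flat nu i) b).
Proof.
rewrite scanK_atS /colour modnDr divnDr // divnn /= addn1 /=.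
by [].
Qed.

Lemma run_scanK f s c : (c <= k.+1)%N ->
  run scanK_step (st0 k, st0 k) f (s * k.+1 + c) =
  (mix c (pres (unflat f) nu s) (presS (unflat f) nu s),
   mix c (pres (unflat f) mu s) (presS (unflat f) mu s)).
Proof.
apply: (run_sites (g := fun s c =>
  (mix c (pres (unflat f) nu s) (presS (unflat f) nu s),
   mix c (pres (unflat f) mu s) (presS (unflat f) mu s)))).
- by rewrite !mix0.
- by move=> s'; rewrite !mix0 !mixk.
move=> s' c'; rewrite /scanK_step /stepK colourE divnMDl // divn_small // addn0 /= !mix_at.
by congr pair; apply: upd_mix; rewrite ffunE edge_shift.
Qed.

(** Because of the look-ahead, the conditions tested together belong to two sites: the top particles
    are checked at site [s - 1], the clashes at site [s]. *)
Definition rowK1 z B C S : A :=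
  \prod_(s < S) \prod_(c : K)
    if (shift C s c ==> presS B C s c) && ~~ (edge B C s c && B s c)
    then z ^+ edge B C s c * t ^+ (edge B C s c * hi c (presS B C s)) else 0.
Definition rowK2 z B C S : A :=
  \prod_(s < S) \prod_(c : K)
    if (shift C s c ==> presS B C s c) && ~~ (edge B C s c && B s c)
    then z ^+ edge B C s c * t ^+ (edge B C s c * lo c (pres B C s)) else 0.

Lemma scanKE S F : scanK (S * k.+1) F =
  \sum_(w : (S * k.+1).-tuple bool)
    let C := unflat (nth false w) in
    rowK1 x C nu S * rowK2 y C mu S * F (presS C nu S, presS C mu S).
Proof.
rewrite /scanK (transferE _ _ _ false); apply: eq_bigr => w _ /=.
set f := nth false w; set C := unflat f.
have := @run_scanK f S 0 isT; rewrite addn0 !mix0 => ->; congr (_ * _).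
rewrite (big_ord_mul _ _ _ (fun i => scanK_wt i (run scanK_step (st0 k, st0 k) f i) (f i))).
rewrite -big_split; apply: eq_bigr => s _; rewrite -big_split; apply: eq_bigr => c _ /=.
rewrite (run_scanK _ _ (ltnW (ltn_ord c))) /scanK_wt /wtKf colourE divnMDl // divn_small //.
rewrite addn0 /= !mix_at lo_mix hi_mix -/C -[f _]/(C s c) exprD mulrACA if_and4.
by rewrite -!edge_shift.
Qed.
End ScanK.

Arguments edge {k} B C s : simpl never.

(** * Regrouping scan weights into row weights *)

Section RowRegroup.
Variable k : nat.
Local Notation K := 'I_k.+1.
Local Notation st := {ffun K -> bool}.
Local Notation bits := (nat -> K -> bool).
Implicit Types (P Q : st) (B C : bits).
Variables (A : comNzRingType) (t z : A).

Lemma prod_if (I : finType) (b : I -> bool) (u : I -> A) :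
  \prod_i (if b i then u i else 0) = (\prod_i (b i)%:R) * \prod_i u i.
Proof.
by rewrite -big_split; apply: eq_bigr => i _ /=; case: (b i); rewrite ?mul1r ?mul0r.
Qed.

Lemma prod_natb (I : finType) (b : I -> bool) : \prod_i ((b i)%:R : A) = [forall i, b i]%:R.
Proof.
case: forallP => [h|/forallP].
  by rewrite big1 // => i _; rewrite h.
by rewrite negb_forall => /existsP[i /negPf bi]; rewrite (bigD1 i) //= bi mul0r.
Qed.

(** Both exponents count the pairs of colours [o < c] with [o] in [Q] and [c] in [P]. *)
Lemma exchange_lo_hi (P Q : st) :
  \prod_(c : K) t ^+ (P c * lo c Q) = \prod_(c : K) t ^+ (Q c * hi c P).
Proof.
rewrite -!expr_sum; congr (_ ^+ _).
under eq_bigr do rewrite big_distrr /=.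
under [RHS]eq_bigr do rewrite big_distrr /=.
rewrite (exchange_big_dep xpredT) //=.
by apply: eq_bigr => c _; apply: eq_bigr => o _; rewrite mulnC.
Qed.

Definition noclash B C s : bool := [forall c, ~~ (edge B C s c && B s c)].
Definition covers B C s : bool := [forall c, C s c ==> pres B C s c].

Lemma raw1E B C S : raw1 t z B C S = \prod_(s < S)
  ((noclash B C s)%:R * ((covers B C s)%:R * ((\prod_(c : K) z ^+ edge B C s.+1 c) *
   \prod_(c : K) t ^+ (edge B C s.+1 c * hi c (pres B C s))))).
Proof.
apply: eq_bigr => s _; rewrite prod_if big_split /= exchange_lo_hi mulrA; congr (_ * _).
by rewrite /noclash /covers -!prod_natb -big_split; apply: eq_bigr => c _ /=; rewrite -natrM mulnb.
Qed.

Lemma raw2E B C S : raw2 t z B C S = \prod_(s < S)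
  ((noclash B C s)%:R * ((covers B C s)%:R * ((\prod_(c : K) z ^+ edge B C s.+1 c) *
   \prod_(c : K) t ^+ (pres B C s c * hi c (edge B C s))))).
Proof.
apply: eq_bigr => s _; rewrite prod_if big_split /= mulrA; congr (_ * _).
by rewrite /noclash /covers -!prod_natb -big_split; apply: eq_bigr => c _ /=; rewrite -natrM mulnb.
Qed.

Definition coversS B C s : bool := if s is s'.+1 then covers B C s' else true.

Lemma rowK_if B C s (u : K -> A) :
  \prod_(c : K) (if (shift C s c ==> presS B C s c) && ~~ (edge B C s c && B s c)
     then u c else 0) = (coversS B C s)%:R * ((noclash B C s)%:R * \prod_c u c).
Proof.
rewrite prod_if mulrA; congr (_ * _); rewrite /noclash -prod_natb.
have -> : coversS B C s = [forall c, shift C s c ==> presS B C s c].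
  by case: s => //=; apply/esym/forallP.
by rewrite -prod_natb -big_split; apply: eq_bigr => c _ /=; rewrite -natrM mulnb.
Qed.

(** No path enters site 0, so the first covering condition and the first edge factor are trivial;
    the remaining ones move down by one site. *)
Lemma rowK1_recl B C S : rowK1 t z B C S.+1 =
  (\prod_(s < S.+1) (noclash B C s)%:R) * \prod_(s < S) ((covers B C s)%:R *
    ((\prod_(c : K) z ^+ edge B C s.+1 c) *
     \prod_(c : K) t ^+ (edge B C s.+1 c * hi c (pres B C s)))).
Proof.
rewrite /rowK1; under eq_bigr do rewrite rowK_if.
rewrite [in RHS]big_ord_recl big_ord_recl /= mul1r.
rewrite [X in _ * X * _]big1 => [|c _]; last by rewrite ffunE !mul0n mulr1.
rewrite mulr1 -mulrA; congr (_ * _); rewrite -big_split /=.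
by apply: eq_bigr => s _; rewrite big_split /= mulrCA.
Qed.

Lemma rowK2_recl B C S : rowK2 t z B C S.+1 =
  (\prod_(s < S.+1) ((noclash B C s)%:R * 
     \prod_(c : K) t ^+ (pres B C s c * hi c (edge B C s)))) *
  \prod_(s < S) ((covers B C s)%:R * \prod_(c : K) z ^+ edge B C s.+1 c).
Proof.
have E s : \prod_(c : K) t ^+ (edge B C s c * lo c (pres B C s)) =
           \prod_(c : K) t ^+ (pres B C s c * hi c (edge B C s)).
  exact: exchange_lo_hi.
rewrite /rowK2; under eq_bigr do rewrite rowK_if big_split /= E.
rewrite [LHS]big_ord_recl [X in _ = X * _]big_ord_recl /= mul1r.
rewrite [X in _ * (X * _) * _]big1 => [|c _]; last by rewrite ffunE.
rewrite mul1r -[RHS]mulrA; congr (_ * _); rewrite -big_split /=.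
by apply: eq_bigr => s _; rewrite mulrCA -!mulrA; congr (_ * _); rewrite mulrA mulrC.
Qed.

(** The scan ends before the last site has been tested completely. The missing conditions, that its
    top particles are covered and that no path leaves it, amount to prescribing the end state. *)
Lemma covers_closed B C S :
  covers B C S && is_closed B C S.+1 = (presS B C S.+1 == [ffun c => C S c]).
Proof.
apply/andP/eqP => [[/forallP h /eqP/ffunP cl]|/ffunP h].
  apply/ffunP => c; have := cl c; have := h c; rewrite edgeS !ffunE.
  by case: (C S c); case: (_ || _).
split; first by apply/forallP => c; have := h c; rewrite [LHS]/= [RHS]ffunE => ->; rewrite implybb.
apply/eqP/ffunP => c; have := h c; rewrite [LHS]/= [RHS]ffunE edgeS => ->.
by rewrite andbN ffunE.
Qed.

Lemma rowK1E B C S :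
  rowK1 t z B C S.+1 * (presS B C S.+1 == [ffun c => C S c])%:R = row1 t z B C S.+1.
Proof.
rewrite rowK1_recl /row1 raw1E -covers_closed [X in _ = X * _]big_split /=.
rewrite -mulrA -[RHS]mulrA; congr (_ * _).
rewrite [X in _ = X * _]big_ord_recr /= -[RHS]mulrA; congr (_ * _).
rewrite -mulnb natrM -[RHS]mulrA; congr (_ * _).
have [/eqP cl|] := boolP (is_closed B C S.+1); last by rewrite mulr0.
by rewrite !big1 ?mulr1 // => c _; rewrite cl ffunE ?mul0n.
Qed.

Lemma rowK2E B C S :
  rowK2 t z B C S.+1 * (presS B C S.+1 == [ffun c => C S c])%:R = row2 t z B C S.+1.
Proof.
rewrite rowK2_recl /row2 raw2E -covers_closed.
rewrite [X in _ = X * _](eq_bigr (fun s : 'I_S.+1 => ((noclash B C s)%:R * 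
     \prod_(c : K) t ^+ (pres B C s c * hi c (edge B C s))) *
   ((covers B C s)%:R * \prod_(c : K) z ^+ edge B C s.+1 c))); last first.
  by move=> s _; rewrite -!mulrA; congr (_ * _); rewrite [RHS]mulrC -mulrA.
rewrite [X in _ = X * _]big_split /= -mulrA -[RHS]mulrA; congr (_ * _).
rewrite [X in _ = X * _]big_ord_recr /= -[RHS]mulrA; congr (_ * _).
rewrite -mulnb natrM -[RHS]mulrA; congr (_ * _).
have [/eqP cl|] := boolP (is_closed B C S.+1); last by rewrite mulr0.
by rewrite big1 ?mulr1 // => c _; rewrite cl ffunE.
Qed.
End RowRegroup.

(** * The commutation relation *)

Section Commutation.
Variable k : nat.
Local Notation K := 'I_k.+1.
Local Notation st := {ffun K -> bool}.
Local Notation bits := (nat -> K -> bool).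
Implicit Types (P Q : st) (B C : bits).
Variables (A : comNzRingType) (t x y : A) (mu nu : bits).

(* The recursion of the kappa-scan, started from the value of the intertwiner at
   the empty lambda-state instead of from a delta at the empty state. The two
   initial values agree where all colours are in flight, and only this state
   survives the first site, which is full in mu and nu. *)
Fixpoint scanR i (s' : st * st) : A :=
  if i is j.+1 then
    \sum_(b : bool) wtK x y t (colour k j) s' (flat mu j) (flat nu j) b *
       scanR j (unstepK (colour k j) s' (flat mu j) (flat nu j) b)
  else Rmat x y t 0 (st0 k, st0 k) s'.

(** When all colours or none have been processed, no pair of colours is split, so the end of one
    site can serve as the beginning of the next. *)
Lemma Rmat_wrap (s s' : st * st) : Rmat x y t k.+1 s s' = Rmat x y t 0 s s'.
Proof.
rewrite /Rmat /rho; case: ifP => // _; congr (t ^+ _ * _).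
apply: eq_bigr => a _; apply: eq_bigr => b _.
by rewrite [(k.+1 <= b)%N]leqNgt !ltn_ord.
Qed.

Lemma Rmat_next i (s s' : st * st) :
  Rmat x y t (i.+1 %% k.+1)%N s s' = Rmat x y t (colour k i).+1 s s'.
Proof.
rewrite /colour inordK ?ltn_pmod // -[i.+1]addn1 -modnDml addn1.
have := ltn_pmod i (ltn0Sn k); rewrite leq_eqVlt => /predU1P[->|lt].
  by rewrite modnn Rmat_wrap.
by rewrite modn_small.
Qed.

(** The intertwiner is carried through the lambda-scan one letter at a time, by [exchange_local]. *)
Lemma scanRE i s' :
  scanR i s' = scanL t x y mu nu i (fun s => Rmat x y t (i %% k.+1)%N s s').
Proof.
elim: i s' => [|i IH] s'; first by rewrite mod0n.
rewrite /scanL /= -/(scanL t x y mu nu i _).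
under eq_bigr do rewrite IH.
rewrite -transfer_sum; apply: eq_transfer => s.
have -> : (i %% k.+1 = colour k i)%N by rewrite /colour inordK ?ltn_pmod.
rewrite -exchange_local; apply: eq_bigr => b _; congr (_ * _).
by rewrite Rmat_next.
Qed.

Lemma scanK_at_zero c (s' : st * st) (o : K) :
  (c <= o)%N -> s'.1 o -> scanK_at t x y mu nu c s' = 0.
Proof.
elim: c s' => [|c IH] s' co so.
  rewrite /scanK_at /scanK /=; case: eqP => // e.
  by move: so; rewrite -e ffunE.
rewrite scanK_atS big1 // => b _; rewrite IH ?mulr0 ?(ltnW co) //=.
rewrite upd_neq //; apply/eqP => oc; move: co.
by rewrite oc /colour inordK ?ltn_pmod // ltnNge leq_mod.
Qed.

Definition ones (c : nat) : st := [ffun o : K => (o < c)%N].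

Lemma scanK_at_ones c : (c <= k.+1)%N -> scanK_at t x y mu nu c (ones c, ones c) = 1.
Proof.
elim: c => [|c IH] ck.
  have -> : ones 0 = st0 k by apply/ffunP => o; rewrite !ffunE.
  by rewrite /scanK_at /scanK /= eqxx.
have cE : colour k c = Ordinal ck by apply/val_inj; rewrite /= inordK ?modn_small // ltn_pmod.
rewrite scanK_atS divn_small // cE /= big_bool /= /wtK /= !ffunE /= ltnSn /= !mul0n !mulr1 mul1r.
rewrite [X in _ + X](_ : _ = 0) ?addr0.
  rewrite -[RHS](IH (ltnW ck)); congr (scanK_at _ _ _ _ _ _ (_, _));
  apply/ffunP => o; rewrite !ffunE -val_eqE /= andbF; case: eqP => [->|]; rewrite ?ltnn //; lia.
rewrite (@scanK_at_zero _ _ (Ordinal ck)) ?mulr0 //=.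
by rewrite upd_eq /= !ffunE /= ltnSn.
Qed.

Hypotheses (mu0 : forall c, mu 0%N c) (nu0 : forall c, nu 0%N c).

Lemma Rmat_ones : Rmat x y t 0 (st0 k, st0 k) (ones k.+1, ones k.+1) = 1.
Proof.
rewrite /Rmat ifT; last by apply/forallP => o; rewrite /compat_at /= !ffunE ltn_ord.
rewrite /rho big1 => [|a _]; last first.
  by rewrite big1 // => b _; rewrite /= ffunE muln0.
rewrite big1 => [|o _]; first by rewrite /qfact big_ord0 mulr1.
by rewrite /defect /= !ffunE ltn_ord.
Qed.

(** Since mu and nu are full at site 0, undoing a step there sets both flight bits of its colour.
    Going back through the whole site thus leads to the state with all colours in flight, where both
    initial values are 1. *)
Lemma scanR_first c (s' : st * st) : (c <= k.+1)%N ->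
  (forall o : K, (c <= o)%N -> s'.1 o && s'.2 o) ->
  scanR c s' = scanK_at t x y mu nu (c + k.+1) s'.
Proof.
elim: c s' => [|c IH] s' ck ones_s.
  rewrite add0n /= (_ : s' = (ones k.+1, ones k.+1)).
    by rewrite Rmat_ones scanK_at_ones.
  case: s' ones_s => P Q h; congr pair; apply/ffunP => o; rewrite ffunE ltn_ord;
  by have /andP[] := h o isT.
rewrite addSn scanK_atD /=; apply: eq_bigr => b _; congr (_ * _).
have cE : colour k c = Ordinal ck by apply/val_inj; rewrite /= inordK ?modn_small // ltn_pmod.
have flat1 (B : bits) : (forall c, B 0%N c) -> flat B c = true.
  by move=> B1; rewrite /flat divn_small // B1.
apply: IH => [|o]; first exact: ltnW.
rewrite !flat1 // leq_eqVlt => /predU1P[co|co] /=.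
  have -> : colour k c = o by rewrite cE; apply: val_inj.
  by rewrite !upd_eq !orbT.
rewrite !upd_neq ?ones_s //; rewrite cE -val_eqE /=; lia.
Qed.

Lemma scanR_scanK i s' : scanR (k.+1 + i) s' = scanK_at t x y mu nu (k.+1 + i + k.+1) s'.
Proof.
elim: i s' => [|i IH] s'.
  by rewrite addn0; apply: scanR_first => // o; rewrite leqNgt ltn_ord.
rewrite (addnS k.+1 i) (addSn _ k.+1) scanK_atD /=; apply: eq_bigr => b _; congr (_ * _); exact: IH.
Qed.

(** The look-ahead makes the scan read one site beyond the strip. An empty end state forces kappa to
    be empty there, and the state one site earlier then holds exactly the particles of nu and mu at
    the last site. *)
Lemma scanK_at_tail S c : (c <= k.+1)%N ->
  scanK_at t x y mu nu (S.+1 * k.+1 + c)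
    (mix c (st0 k) [ffun o => nu S o], mix c (st0 k) [ffun o => mu S o]) =
  scanK_at t x y mu nu (S.+1 * k.+1) ([ffun o => nu S o], [ffun o => mu S o]).
Proof.
elim: c => [|c IH] ck; first by rewrite addn0 !mix0.
rewrite -IH ?(ltnW ck) // addnS scanK_atS.
have := @colourE k S.+1 (Ordinal ck); rewrite /= => ->.
rewrite divnMDl // divn_small // addn0 /=.
have mix_false P : mix c.+1 (st0 k) P (Ordinal ck) = false by rewrite !ffunE /= ltnSn.
have mix_upd P v : v = P (Ordinal ck) ->
    upd (mix c.+1 (st0 k) P) (Ordinal ck) v = mix c (st0 k) P.
  move=> ->; apply/ffunP => o; rewrite !ffunE ltnS leq_eqVlt -val_eqE /=.
  by case: eqP => //= e; rewrite e ltnn; congr (P _); apply: val_inj.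
rewrite big_bool /= /wtK /unstepK /= !mix_false /= !mul0n mul0r add0r !mulr1 mul1r.
by rewrite !mix_upd // ffunE.
Qed.

Definition full_qfact : A := \prod_(m < k.+1) (1 - x * y * t ^+ m).

(** Compatibility with the empty kappa-state forces [P = Q]. If both are empty, all defects vanish
    and [qfact] is complete; otherwise paths leave the strip, and the term is kept as an error. *)
Lemma Rmat_final P Q : Rmat x y t 0 (P, Q) (st0 k, st0 k) =
  ((P == st0 k)%:R * (Q == st0 k)%:R) * full_qfact +
  (Q != st0 k)%:R * Rmat x y t 0 (P, Q) (st0 k, st0 k).
Proof.
case: (eqVneq Q) => [->|nQ] /=; last by rewrite mulr0 mul0r add0r mul1r.
rewrite mul0r addr0 mulr1; case: (eqVneq P) => [->|nP]; last first.
  rewrite mul0r /Rmat ifN //; apply: contraNN nP => /forallP h.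
  apply/eqP/ffunP => o; have := h o; rewrite /compat_at /= !ffunE.
  by case: (P o).
rewrite mul1r /Rmat ifT; last by apply/forallP => o; rewrite /compat_at /= !ffunE.
rewrite /rho big1 => [|a _]; last first.
  by rewrite big1 // => b _; rewrite /= ffunE muln0.
rewrite mul1r /qfact /full_qfact (eq_bigr (fun=> 1%N)); last first.
  by move=> o _; rewrite /defect /= !ffunE.
rewrite sum1_card card_ord (reindex_inj rev_ord_inj) /=.
by apply: eq_bigr => i _; rewrite subSS subKn // -ltnS.
Qed.

(* The second sum collects the rows in which some path runs off the strip. *)
Lemma commutation S :
  full_qfact * (\sum_(w : (S.+1 * k.+1).-tuple bool)
     let C := unflat (nth false w) in
     row1 t x mu C S.+1 * row2 t y nu C S.+1) +
  \sum_(w : (S.+1 * k.+1).-tuple bool)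
     (let C := unflat (nth false w) in
     raw1 t x mu C S.+1 * raw2 t y nu C S.+1 * (~~ is_closed nu C S.+1)%:R *
     Rmat x y t 0 (edge mu C S.+1, edge nu C S.+1) (st0 k, st0 k))
  = \sum_(w : (S.+1 * k.+1).-tuple bool)
     let C := unflat (nth false w) in
     row1 t x C nu S.+1 * row2 t y C mu S.+1.
Proof.
transitivity (scanR (S.+1 * k.+1) (st0 k, st0 k)).
  rewrite scanRE modnMl scanLE big_distrr -big_split /=; apply: eq_bigr => w _.
  rewrite [in RHS]Rmat_final mulrDr /is_closed /row1 /row2 /is_closed; congr (_ + _).
    by ring.
  by rewrite mulrA.
rewrite mulSn scanR_scanK -mulSn.
have := @scanK_at_tail S k.+1 (leqnn _); rewrite !mixk => ->.
rewrite /scanK_at scanKE; apply: eq_bigr => w _ /=.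
by rewrite xpair_eqE -mulnb natrM mulrACA !rowK1E !rowK2E.
Qed.
End Commutation.

(** * Conservation of particles along a row *)

Section RowFacts.
Variable k : nat.
Local Notation K := 'I_k.+1.
Local Notation bits := (nat -> K -> bool).
Implicit Types (B C : bits).
Variables (A : comNzRingType) (t : A).

Lemma raw1_unsound z B C S s c : (s < S)%N -> ~~ sound B C s c -> raw1 t z B C S = 0.
Proof.
move=> sS /negPf h; rewrite /raw1 (bigD1 (Ordinal sS)) //= (bigD1 c) //= h.
by rewrite !mul0r.
Qed.

Lemma raw2_unsound z B C S s c : (s < S)%N -> ~~ sound B C s c -> raw2 t z B C S = 0.
Proof.
move=> sS /negPf h; rewrite /raw2 (bigD1 (Ordinal sS)) //= (bigD1 c) //= h.
by rewrite !mul0r.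
Qed.

Definition particles B (c : K) s : nat := (\sum_(i < s) B i c)%N.

Lemma particlesS B c s : particles B c s.+1 = (particles B c s + B s c)%N.
Proof. by rewrite /particles big_ord_recr. Qed.

(** Conservation law: a bottom particle starting left of the bond either stops left of it or is in
    flight across it. *)
Lemma edge_count B C c s : (forall i, (i < s)%N -> sound B C i c) ->
  particles B c s = (particles C c s + edge B C s c)%N.
Proof.
elim: s => [|s IH] snd; first by rewrite /particles !big_ord0 ffunE.
rewrite !particlesS IH => [|i lt_is]; last exact/snd/ltnW.
have := snd s (leqnn _); rewrite /sound edgeS !ffunE.
by case: (edge B C s c); case: (B s c); case: (C s c) => //=; lia.
Qed.

Lemma particles_le B c s s' : (s <= s')%N -> (particles B c s <= particles B c s')%N.
Proof.
move=> le; rewrite -(subnKC le); elim: (s' - s)%N => [|d IH]; first by rewrite addn0.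
by rewrite addnS particlesS (leq_trans IH) ?leq_addr.
Qed.

Lemma particles_bound B c s : (particles B c s <= s)%N.
Proof.
elim: s => [|s IH]; first by rewrite /particles big_ord0.
by rewrite particlesS; case: (B s c); lia.
Qed.

Definition packed (n : nat) : bits := fun s _ => (s < n)%N.

Lemma particles_packed n c s : particles (packed n) c s = minn s n.
Proof.
elim: s => [|s IH]; first by rewrite /particles big_ord0 min0n.
by rewrite particlesS IH /packed; case: ltnP => /=; lia.
Qed.

Lemma edge_packed n B C s c : (forall s c, C s c = packed n s c) ->
  (s <= n)%N -> edge B C s c = false.
Proof. by case: s => [|s] Cn sn; rewrite ?edgeS ?Cn /packed ?sn ?andbF // ffunE. Qed.

(** Within the packed block, every path is stopped at once by the top configuration. Beyond the
    block nothing stops a path, so one that crosses a later bond would leave the strip. *)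
Lemma packed_edges n B C S : (forall s c, C s c = packed n s c) -> (n <= S)%N ->
  (forall s c, (s < S)%N -> sound B C s c) -> is_closed B C S ->
  (forall s c, (s < S)%N -> B s c = packed n s c) /\
  (forall s c, (s <= S)%N -> edge B C s c = false).
Proof.
move=> Cn nS snd /eqP/ffunP cl.
have edge0 s c : (s <= S)%N -> edge B C s c = false.
  move=> sS; have [sn|ns] := leqP s n; first exact: (edge_packed _ _ Cn).
  apply: contraFF (_ : edge B C S c = false); last by rewrite cl ffunE.
  move=> e; rewrite -(subnKC sS); elim: (S - s)%N => [|d IH]; first by rewrite addn0.
  by rewrite addnS edgeS ffunE IH Cn /packed /=; lia.
split=> // s c sS; have := edge0 s.+1 c sS; have := snd s c sS.
rewrite /sound edgeS ffunE edge0 ?(ltnW sS) // Cn.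
by case: (packed n s c); case: (B s c).
Qed.

Lemma raw1_noedge z B C S : (forall s c, (s < S)%N -> sound B C s c) ->
  (forall s c, (s <= S)%N -> edge B C s c = false) -> raw1 t z B C S = 1.
Proof.
move=> snd e0; rewrite /raw1 big1 // => s _; rewrite big1 // => c _.
rewrite snd // e0 // /lo big1 ?muln0 ?mulr1 // => o _.
by rewrite e0.
Qed.

Lemma raw2_noedge z B C S : (forall s c, (s < S)%N -> sound B C s c) ->
  (forall s c, (s <= S)%N -> edge B C s c = false) -> raw2 t z B C S = 1.
Proof.
move=> snd e0; rewrite /raw2 big1 // => s _; rewrite big1 // => c _.
rewrite snd // e0 // /hi big1 ?muln0 ?mulr1 // => o _.
by rewrite e0 // ltnW.
Qed.
End RowFacts.

(** * Chains of configurations *)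

Section Chains.
Variables (k S' : nat).
Local Notation K := 'I_k.+1.
Local Notation S := S'.+1.
Definition conf := (S * k.+1).-tuple bool.
Implicit Types (B C w : conf).

Definition bit w : nat -> K -> bool := unflat (nth false w).

Lemma bit_out w s c : (S <= s)%N -> bit w s c = false.
Proof.
move=> Ss; rewrite /bit /unflat nth_default // size_tuple.
by rewrite (leq_trans _ (leq_addr _ _)) // leq_mul.
Qed.

Lemma conf_eq B C : (forall s c, (s < S)%N -> bit B s c = bit C s c) -> B = C.
Proof.
move=> h; apply: (@eq_from_tnth); move=> i; rewrite !(tnth_nth false).
have iS : (i %/ k.+1 < S)%N by rewrite ltn_divLR.
have := h (i %/ k.+1)%N (inord (i %% k.+1)) iS; rewrite /bit /unflat.
by rewrite inordK ?ltn_pmod // -divn_eq.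
Qed.

Definition mkconf (f : nat -> K -> bool) : conf :=
  [tuple flat f i | i < S * k.+1].

Lemma bit_mkconf f s c : (s < S)%N -> bit (mkconf f) s c = f s c.
Proof.
move=> sS; have lt : (s * k.+1 + c < S * k.+1)%N.
  by rewrite (leq_trans (_ : _ < s.+1 * k.+1)%N) // ?leq_mul // mulSnr ltn_add2l.
by rewrite /bit /unflat -[LHS](tnth_nth false _ (Ordinal lt)) tnth_mktuple flatE.
Qed.

Variables (A : comNzRingType) (n : nat).
Hypothesis n_le : (n <= S)%N.
Hypothesis n_gt0 : (0 < n)%N.

Definition vacuum : conf := mkconf (@packed k n).

Lemma bit_vacuum s c : bit vacuum s c = @packed k n s c.
Proof.
have [sS|Ss] := ltnP s S; first exact: bit_mkconf.
by rewrite bit_out // /packed ltnNge (leq_trans n_le).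
Qed.

Section Step.
Variable r : nat -> conf -> conf -> A.

Fixpoint chain m w : A :=
  if m is m'.+1 then \sum_(B : conf) chain m' B * r m' B w
  else (w == vacuum)%:R.

Hypothesis r_sound : forall i B C s c,
  (s < S)%N -> ~~ sound (bit B) (bit C) s c -> r i B C = 0.

(** A particle leaving site [s] crosses to [s + 1], where it would clash with a particle of its
    colour. Hence a row can shorten the full initial block by one site at most. *)
Lemma chain_full j w s c : (s + j < n)%N -> ~~ bit w s c -> chain j w = 0.
Proof.
elim: j w s => [|j IH] w s lt nw /=.
  case: eqP => // e; move: nw; rewrite e bit_vacuum /packed; lia.
rewrite big1 // => B _.
have [Bs|nB] := boolP (bit B s c); last by rewrite (IH _ s) ?mul0r //; lia.
have [Bs1|nB] := boolP (bit B s.+1 c); last by rewrite (IH _ s.+1) ?mul0r //; lia.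
rewrite (r_sound _ (s := s.+1) (c := c)) ?mulr0 //; first lia.
by rewrite /sound edgeS !ffunE Bs Bs1 orbT nw.
Qed.

Hypothesis r_closed : forall i B C, ~~ is_closed (bit B) (bit C) S -> r i B C = 0.

Lemma chain_particles j w c : chain j w != 0 -> particles (bit w) c S = n.
Proof.
elim: j w => [|j IH] w /=.
  case: (w =P vacuum) => [-> _|]; last by rewrite eqxx.
  transitivity (particles (@packed k n) c S); last by rewrite particles_packed (minn_idPr n_le).
  by apply: eq_bigr => i _; rewrite bit_vacuum.
move=> nz; have /existsP[B] : [exists B, chain j B * r j B w != 0].
  apply: contraNT nz; rewrite negb_exists => /forallP h.
  by rewrite big1 // => B _; apply/eqP; have := h B; rewrite negbK.
have [->|cB] := eqVneq (chain j B) 0; first by rewrite mul0r eqxx.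
have [->|rB] := eqVneq (r j B w) 0; first by rewrite mulr0 eqxx.
move=> _; rewrite -(IH B cB).
have cl : is_closed (bit B) (bit w) S by apply: contraNT rB => /r_closed->.
rewrite (@edge_count _ (bit B) (bit w)); last first.
  move=> i iS; apply: contraNT rB => h; apply/eqP; exact: r_sound iS h.
by move/eqP: cl => ->; rewrite ffunE addn0.
Qed.

Hypothesis r_noedge : forall i B C,
  (forall s c, (s < S)%N -> sound (bit B) (bit C) s c) ->
  (forall s c, (s <= S)%N -> edge (bit B) (bit C) s c = false) -> r i B C = 1.

Lemma step_vacuum i B : r i B vacuum = (B == vacuum)%:R.
Proof.
have [->|nB] := eqVneq B vacuum.
  have e0 s c : (s <= S)%N -> edge (bit vacuum) (bit vacuum) s c = false.
    elim: s => [|s IH] sS; first by rewrite ffunE.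
    by rewrite edgeS ffunE IH ?(ltnW sS) // andbN.
  apply: r_noedge => // s c sS; rewrite /sound e0 ?(ltnW sS) //= ffunE.
  by rewrite e0 ?(ltnW sS) //= implybb.
have [snd|/forallPn[s /forallPn[c h]]] :=
  boolP [forall s : 'I_S, forall c, sound (bit B) (bit vacuum) s c]; last first.
  exact: r_sound h.
have {}snd s c : (s < S)%N -> sound (bit B) (bit vacuum) s c.
  by move=> sS; have /forallP/(_ c) := forallP snd (Ordinal sS).
apply: r_closed; apply: contraNN nB => cl; apply/eqP; apply: conf_eq => s c sS.
by rewrite bit_vacuum; have [-> ] := packed_edges bit_vacuum n_le snd cl.
Qed.

Lemma chain_vacuum j : chain j vacuum = 1.
Proof.
elim: j => [|j IH] /=; first by rewrite eqxx.
rewrite (bigD1 vacuum) //= IH mul1r step_vacuum eqxx big1 ?addr0 // => B nB.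
by rewrite step_vacuum (negPf nB) mulr0.
Qed.
End Step.

(* [J d] stands for the series without terms of degree less than [d]. *)
Variable J : nat -> A -> Prop.
Hypothesis J_zero : forall d, J d 0.
Hypothesis J_any : forall a, J 0 a.
Hypothesis J_add : forall d a b, J d a -> J d b -> J d (a + b).
Hypothesis J_mul : forall d e a b, J d a -> J e b -> J (d + e) (a * b).
Hypothesis J_weak : forall d e a, (e <= d)%N -> J d a -> J e a.

Lemma J_sum (I : finType) d (F : I -> A) : (forall i, J d (F i)) -> J d (\sum_i F i).
Proof. by move=> h; elim/big_ind: _ => // a b; apply: J_add. Qed.

Lemma J_prod (I : finType) (d : I -> nat) (F : I -> A) :
  (forall i, J (d i) (F i)) -> J (\sum_i d i) (\prod_i F i).
Proof.
move=> h; rewrite !unlock /=; elim: (index_enum I) => //= i s IH.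
exact: J_mul.
Qed.

Lemma J_mulr d a b : J d b -> J d (a * b).
Proof. by move=> h; rewrite -[d]add0n; apply: J_mul. Qed.

Variable t : A.
Variables xs ys : nat -> A.
Hypothesis J_ys : forall i, J 1 (ys i).

Definition edges B C : nat :=
  (\sum_(s < S) \sum_(c : K) edge (bit B) (bit C) s.+1 c)%N.

Lemma J_raw2 i B C : J (edges B C) (raw2 t (ys i) (bit B) (bit C) S).
Proof.
apply: J_prod => s; apply: J_prod => c; case: ifP => // _.
rewrite -[X in J X]addn0; apply: J_mul => //.
by case: (edge _ _ _ _); rewrite ?expr1.
Qed.

(** A particle at site [i] contributes [S - i], so each unit step to the right costs one unit. *)
Definition energy B : nat := (\sum_(s < S) \sum_(c : K) particles (bit B) c s.+1)%N.

Lemma energy_edges B C : (forall s c, (s < S)%N -> sound (bit B) (bit C) s c) ->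
  energy B = (energy C + edges B C)%N.
Proof.
move=> snd; rewrite /energy /edges -big_split; apply: eq_bigr => s _.
rewrite -big_split; apply: eq_bigr => c _ /=; apply: edge_count => i ilt.
by apply: snd; apply: leq_trans ilt (ltn_ord s).
Qed.

Definition weight1 i B C := row1 t (xs i) (bit B) (bit C) S.
Definition weight2 i B C := row2 t (ys i) (bit B) (bit C) S.

Lemma soundP B C :
  (forall s c, (s < S)%N -> sound (bit B) (bit C) s c) \/
  (exists s c, (s < S)%N /\ ~~ sound (bit B) (bit C) s c).
Proof.
have [snd|/forallPn[s /forallPn[c h]]] :=
  boolP [forall s : 'I_S, forall c, sound (bit B) (bit C) s c]; last first.
  by right; exists s, c.
by left=> s c sS; have /forallP/(_ c) := forallP snd (Ordinal sS).
Qed.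

Lemma J_chain_raw2 j m B C : J (energy vacuum - energy B) (chain weight2 j B) ->
  J (energy vacuum - energy C) (chain weight2 j B * raw2 t (ys m) (bit B) (bit C) S).
Proof.
move=> h; have [snd|[s [c [sS h']]]] := soundP B C; last first.
  by rewrite (raw2_unsound _ _ sS h') mulr0.
apply: J_weak (J_mul h (J_raw2 m B C)).
by rewrite (energy_edges snd); lia.
Qed.

Lemma J_chain j B : J (energy vacuum - energy B) (chain weight2 j B).
Proof.
elim: j B => [|j IH] B /=.
  by case: eqP => [->|_]; rewrite ?subnn.
apply: J_sum => C; rewrite /weight2 /row2 mulrA mulrC; apply: J_mulr.
exact: J_chain_raw2.
Qed.

Lemma weight1_unsound i B C s c :
  (s < S)%N -> ~~ sound (bit B) (bit C) s c -> weight1 i B C = 0.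
Proof. by move=> sS h; rewrite /weight1 /row1 (raw1_unsound _ _ sS h) mul0r. Qed.
Lemma weight2_unsound i B C s c :
  (s < S)%N -> ~~ sound (bit B) (bit C) s c -> weight2 i B C = 0.
Proof. by move=> sS h; rewrite /weight2 /row2 (raw2_unsound _ _ sS h) mul0r. Qed.
Lemma weight1_open i B C : ~~ is_closed (bit B) (bit C) S -> weight1 i B C = 0.
Proof. by move=> /negPf h; rewrite /weight1 /row1 h mulr0. Qed.
Lemma weight2_open i B C : ~~ is_closed (bit B) (bit C) S -> weight2 i B C = 0.
Proof. by move=> /negPf h; rewrite /weight2 /row2 h mulr0. Qed.

Lemma closed_noedge B C : (forall s c, (s <= S)%N -> edge (bit B) (bit C) s c = false) ->
  is_closed (bit B) (bit C) S.
Proof. by move=> h; apply/eqP/ffunP => c; rewrite h // ffunE. Qed.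

Lemma weight2_noedge i B C : (forall s c, (s < S)%N -> sound (bit B) (bit C) s c) ->
  (forall s c, (s <= S)%N -> edge (bit B) (bit C) s c = false) -> weight2 i B C = 1.
Proof.
by move=> h e; rewrite /weight2 /row2 raw2_noedge // closed_noedge ?mulr1.
Qed.

(* The degree is the loss of energy since the vacuum; a configuration that lost a
   particle to the right end of the strip has lost at least [S - n]. *)
Lemma J_open j m B C : ~~ is_closed (bit B) (bit C) S ->
  J (S - n) (chain weight2 j B * raw2 t (ys m) (bit B) (bit C) S).
Proof.
move=> op; have [->|nz] := eqVneq (chain weight2 j B) 0; first by rewrite mul0r.
have [snd|[s [c [sS h']]]] := soundP B C; last first.
  by rewrite (raw2_unsound _ _ sS h') mulr0.
apply: J_weak (J_chain_raw2 m C (J_chain j B)).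
have cntB c := chain_particles (@weight2_unsound) (@weight2_open) c nz.
have [c0 ec0] : exists c, edge (bit B) (bit C) S c.
  apply/existsP; apply: contraNT op; rewrite negb_exists => /forallP h.
  by rewrite /is_closed; apply/eqP/ffunP => c; rewrite (negPf (h c)) /st0 ffunE.
have cntC c : (particles (bit C) c S + edge (bit B) (bit C) S c = n)%N.
  by rewrite -(cntB c); apply/esym/edge_count => i iS; apply: snd.
suff : (energy C + (S - n) <= energy vacuum)%N by lia.
have -> : (energy vacuum = \sum_(s < S) \sum_(c : K) minn s.+1 n)%N.
  apply: eq_bigr => s _; apply: eq_bigr => c _; rewrite -(@particles_packed k n c).
  by apply: eq_bigr => i _; rewrite bit_vacuum.
have -> : (S - n = \sum_(s < S) (n <= s))%N.
  transitivity (\sum_(0 <= s < S | (n <= s)%N) 1)%N; last first.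
    by rewrite big_mkord [LHS]big_mkcond.
  rewrite (big_cat_nat _ n_le) //= [X in (_ = X + _)%N]big1_seq ?add0n; last first.
    by move=> i; rewrite mem_index_iota => /andP[]; lia.
  rewrite big_nat_cond (eq_bigl (fun i => (n <= i < S)%N && true)) -?big_nat_cond; last by move=> i; lia.
  by rewrite sum_nat_const_nat muln1.
rewrite -big_split; apply: leq_sum => s _; rewrite (bigD1 c0) //= [X in (_ <= X)%N](bigD1 c0) //=.
rewrite addnAC; apply: leq_add; last first.
  apply: leq_sum => c _; rewrite leq_min particles_bound /= -(cntC c).
  by rewrite (leq_trans (particles_le _ _ (ltn_ord s))) ?leq_addr.
have := cntC c0; rewrite ec0; have := particles_le (bit C) c0 (ltn_ord s).
have := particles_bound (bit C) c0 s.+1; lia.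
Qed.

Definition cauchy_factor x j : A := \prod_(i < j) full_qfact k t x (ys i).

(** Induction on the number of [y]-rows. The commutation relation exchanges [B] with the end of the
    shorter chain, so that afterwards the operator in [x] acts on that shorter chain. *)
Lemma eigen x j B : (j <= n)%N -> (forall c, bit B 0 c) ->
  J (S - n) (cauchy_factor x j *
      (\sum_(C : conf) row1 t x (bit B) (bit C) S * chain weight2 j C)
    - chain weight2 j B).
Proof.
elim: j B => [|j IH] B jn full.
  rewrite /cauchy_factor big_ord0 mul1r /= (bigD1 vacuum) //= eqxx mulr1.
  rewrite big1 ?addr0 => [|C /negPf->]; last by rewrite mulr0.
  rewrite (_ : row1 _ _ _ _ _ = (B == vacuum)%:R) ?subrr //.
  apply: (@step_vacuum (fun _ B C => row1 t x (bit B) (bit C) S) _ _ _ 0%N) => _ {full}B C.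
  - by move=> s c sS h; rewrite /row1 (raw1_unsound _ _ sS h) mul0r.
  - by move=> /negPf h; rewrite /row1 h mulr0.
  - by move=> h e; rewrite /row1 raw1_noedge // closed_noedge ?mulr1.
pose err D := \sum_(C : conf) raw1 t x (bit B) (bit C) S *
   raw2 t (ys j) (bit D) (bit C) S * (~~ is_closed (bit D) (bit C) S)%:R *
   Rmat x (ys j) t 0 (edge (bit B) (bit C) S, edge (bit D) (bit C) S) (st0 k, st0 k).
pose q := full_qfact k t x (ys j).
have comm D : (forall c, bit D 0 c) ->
   q * (\sum_(C : conf) row1 t x (bit B) (bit C) S * weight2 j D C) =
   (\sum_(C : conf) row1 t x (bit C) (bit D) S * weight2 j C B) - err D.
  move=> fullD; apply/eqP; rewrite eq_sym subr_eq eq_sym; apply/eqP.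
  exact: (commutation t x (ys j) full fullD S').
have -> : cauchy_factor x j.+1 *
     (\sum_(C : conf) row1 t x (bit B) (bit C) S * chain weight2 j.+1 C)
    - chain weight2 j.+1 B =
   (\sum_(C : conf) weight2 j C B * (cauchy_factor x j *
     (\sum_(D : conf) row1 t x (bit C) (bit D) S * chain weight2 j D)
      - chain weight2 j C)) - cauchy_factor x j * \sum_(D : conf) chain weight2 j D * err D.
  have -> : \sum_(C : conf) row1 t x (bit B) (bit C) S * chain weight2 j.+1 C =
     \sum_(D : conf) chain weight2 j D *
       (\sum_(C : conf) row1 t x (bit B) (bit C) S * weight2 j D C).
    under eq_bigr do rewrite /= big_distrr /=.
    rewrite exchange_big /=; apply: eq_bigr => D _; rewrite big_distrr /=.
    by apply: eq_bigr => C _; rewrite mulrCA.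
  rewrite /cauchy_factor big_ord_recr -/(cauchy_factor x j) -/q /= -mulrA big_distrr /=.
  rewrite (eq_bigr (fun D => chain weight2 j D *
     ((\sum_(C : conf) row1 t x (bit C) (bit D) S * weight2 j C B) - err D))); last first.
    move=> D _; rewrite mulrCA.
    (* Only configurations full at site 0 contribute, because [j < n] rows cannot empty that
       site. *)
    have [/forallP fD|/forallPn[c nD]] := boolP [forall c, bit D 0 c]; first by rewrite comm.
    by rewrite (chain_full (@weight2_unsound) (s := 0) _ nD) ?mul0r.
  under eq_bigr do rewrite mulrBr.
  rewrite sumrB mulrBr addrAC; congr (_ - _).
  under [in RHS]eq_bigr do rewrite mulrBr.
  rewrite sumrB; congr (_ - _); last by apply: eq_bigr => C _; rewrite mulrC.
  under eq_bigr do rewrite big_distrr /=.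
  rewrite exchange_big /= big_distrr /=; apply: eq_bigr => C _.
  rewrite mulrCA; congr (_ * _); rewrite big_distrr /=; apply: eq_bigr => D _.
  by rewrite mulrC [X in X * _ = _]mulrC -mulrA.
apply: J_add.
  apply: J_sum => C.
  (* No path arrives at site 0 from the left, so the particles of [B] at this site are already
     present in [C]. *)
  have [/forallP fC|/forallPn[c nC]] := boolP [forall c, bit C 0 c].
    by apply: J_mulr; apply: IH => //; exact: ltnW.
  rewrite (weight2_unsound _ (s := 0) (c := c)) ?mul0r //.
  by rewrite /sound !ffunE /= full /= (negPf nC).
rewrite -mulN1r; do 2! apply: J_mulr; apply: J_sum => D; rewrite big_distrr /=.
apply: J_sum => C; have [cl|op] := boolP (is_closed (bit D) (bit C) S).
  by rewrite mulr0 mul0r mulr0.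
rewrite mulr1 (_ : _ * _ = raw1 t x (bit B) (bit C) S *
   Rmat x (ys j) t 0 (edge (bit B) (bit C) S, edge (bit D) (bit C) S) (st0 k, st0 k) *
   (chain weight2 j D * raw2 t (ys j) (bit D) (bit C) S)); last by ring.
by apply: J_mulr; exact: J_open.
Qed.

(** The [x]-rows are passed one by one from the first chain to the second, which is an approximate
    eigenvector. At the end the vacuum remains, where the second chain has the value 1. *)
Lemma cauchy_chains i : (i <= n)%N ->
  J (S - n) ((\prod_(l < i) cauchy_factor (xs l) n) *
    (\sum_(C : conf) chain weight1 i C * chain weight2 n C) - 1).
Proof.
elim: i => [|i IH] le_in.
  rewrite big_ord0 mul1r (bigD1 vacuum) //= eqxx mul1r.
  rewrite (chain_vacuum (@weight2_unsound) (@weight2_open) (@weight2_noedge)).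
  by rewrite big1 ?addr0 ?subrr // => C /negPf->; rewrite mul0r.
have -> : \sum_(C : conf) chain weight1 i.+1 C * chain weight2 n C =
  \sum_(B : conf) chain weight1 i B *
    \sum_(C : conf) row1 t (xs i) (bit B) (bit C) S * chain weight2 n C.
  under eq_bigr do rewrite /= big_distrl /=.
  rewrite exchange_big /=; apply: eq_bigr => B _; rewrite big_distrr /=.
  by apply: eq_bigr => C _; rewrite mulrA.
rewrite big_ord_recr /= -mulrA; set P := \prod_(l < i) _.
pose L B := \sum_(C : conf) row1 t (xs i) (bit B) (bit C) S * chain weight2 n C.
rewrite (_ : _ - 1 = (P * (\sum_(C : conf) chain weight1 i C * chain weight2 n C) - 1) +
   P * (\sum_(B : conf) chain weight1 i B *
     (cauchy_factor (xs i) n * L B - chain weight2 n B))); last first.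
  rewrite [X in _ = _ + P * X](_ : _ = cauchy_factor (xs i) n * (\sum_(B : conf)
     chain weight1 i B * L B) - \sum_(B : conf) chain weight1 i B * chain weight2 n B).
    by ring.
  rewrite big_distrr -sumrB /=; apply: eq_bigr => B _; rewrite mulrBr; congr (_ - _).
  by rewrite mulrCA.
apply: J_add; first exact: IH (ltnW le_in).
apply/J_mulr/J_sum => B.
have [/forallP fB|/forallPn[c nB]] := boolP [forall c, bit B 0 c].
  by apply/J_mulr/eigen.
by rewrite (chain_full (@weight1_unsound) (s := 0) _ nB) ?mul0r.
Qed.
End Chains.

(** * The two statistics of a row *)

Section Inversions.
Variable k : nat.
Local Notation K := 'I_k.+1.
Local Notation bits := (nat -> K -> bool).
Implicit Types (B C : bits).

Definition coinv1 B C S : nat :=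
  (\sum_(s < S) \sum_(c : K) edge B C s.+1 c * hi c (pres B C s))%N.
Definition coinv2 B C S : nat :=
  (\sum_(s < S) \sum_(c : K) pres B C s c * hi c (edge B C s))%N.
(** These are the pairs subtracted in [dstat]: a particle of the larger colour strictly to the left
    of one of the smaller colour. *)
Definition inversions B S : nat :=
  (\sum_(s < S) \sum_(a : K) \sum_(b : K | a < b) B s a * particles B b s)%N.

(** Induction on the length of the strip; the last sum accounts for the paths in flight at its end.
    For a closed row it vanishes, and the two statistics differ by the change of the inversion
    number. *)
Lemma coinv_inversions B C S : (forall s c, (s < S)%N -> sound B C s c) ->
  (coinv1 B C S + inversions B S = coinv2 B C S + inversions C S +
    \sum_(a : K) \sum_(b : K | (a < b)%N) edge B C S a * particles B b S)%N.
Proof.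
elim: S => [|S IH] snd.
  rewrite /coinv1 /coinv2 /inversions !big_ord0 big1 // => a _.
  by rewrite big1 // => b _; rewrite ffunE.
have {IH} := IH (fun s c h => snd s c (ltnW h)).
have E1 : coinv1 B C S.+1 = (coinv1 B C S + \sum_(a : K) edge B C S.+1 a * hi a (pres B C S))%N.
  by rewrite /coinv1 big_ord_recr.
have E2 : coinv2 B C S.+1 = (coinv2 B C S + \sum_(a : K) pres B C S a * hi a (edge B C S))%N.
  by rewrite /coinv2 big_ord_recr.
have E3 D : inversions D S.+1 =
    (inversions D S + \sum_(a : K) \sum_(b : K | (a < b)%N) D S a * particles D b S)%N.
  by rewrite /inversions big_ord_recr.
rewrite E1 E2 !E3 => IH.
suff : (\sum_(a < k.+1) edge B C S.+1 a * hi a (pres B C S) +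
  \sum_(a < k.+1) \sum_(b < k.+1 | (a < b)%N) B S a * particles B b S +
  \sum_(a < k.+1) \sum_(b < k.+1 | (a < b)%N) edge B C S a * particles B b S =
  \sum_(a < k.+1) pres B C S a * hi a (edge B C S) +
  \sum_(a < k.+1) \sum_(b < k.+1 | (a < b)%N) C S a * particles C b S +
  \sum_(a < k.+1) \sum_(b < k.+1 | (a < b)%N) edge B C S.+1 a * particles B b S.+1)%N by lia.
rewrite -!big_split; apply: eq_bigr => a _ /=.
rewrite /hi !big_distrr -!big_split; apply: eq_bigr => b _ /=.
rewrite particlesS (@edge_count _ B C b S); last by move=> i iS; apply: snd; exact: ltnW.
have := snd S a (leqnn _); have := snd S b (leqnn _).
rewrite /sound edgeS !ffunE.
by case: (edge B C S a); case: (edge B C S b); case: (B S a); case: (B S b);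
  case: (C S a) => //=; case: (C S b) => //= _ _; lia.
Qed.

Variables (A : comNzRingType) (t z : A).

Lemma raw1_sound B C S : (forall s c, (s < S)%N -> sound B C s c) ->
  raw1 t z B C S = z ^+ (\sum_(s < S) \sum_(c : K) edge B C s.+1 c)%N * t ^+ coinv1 B C S.
Proof.
move=> snd; rewrite raw1E /coinv1 !expr_sum -big_split; apply: eq_bigr => s _ /=.
rewrite !expr_sum /noclash /covers.
have -> : [forall c, ~~ (edge B C s c && B s c)].
  by apply/forallP => c; have /andP[] := snd s c (ltn_ord s).
have -> : [forall c, C s c ==> pres B C s c].
  by apply/forallP => c; have /andP[] := snd s c (ltn_ord s).
by rewrite !mul1r.
Qed.

Lemma raw2_sound B C S : (forall s c, (s < S)%N -> sound B C s c) ->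
  raw2 t z B C S = z ^+ (\sum_(s < S) \sum_(c : K) edge B C s.+1 c)%N * t ^+ coinv2 B C S.
Proof.
move=> snd; rewrite raw2E /coinv2 !expr_sum -big_split; apply: eq_bigr => s _ /=.
rewrite !expr_sum /noclash /covers.
have -> : [forall c, ~~ (edge B C s c && B s c)].
  by apply/forallP => c; have /andP[] := snd s c (ltn_ord s).
have -> : [forall c, C s c ==> pres B C s c].
  by apply/forallP => c; have /andP[] := snd s c (ltn_ord s).
by rewrite !mul1r.
Qed.
End Inversions.

(** * Conjugation by powers of t *)

Section ChainInversions.
Variables (k S' : nat) (A : comNzRingType) (t : A) (zs : nat -> A) (n : nat).
Local Notation S := S'.+1.
Local Notation conf := (conf k S').
Implicit Types B C : conf.

Lemma weight_inversions i B C :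
  weight1 t zs i B C * t ^+ inversions (bit B) S =
  weight2 t zs i B C * t ^+ inversions (bit C) S.
Proof.
have [snd|[s [c [sS h]]]] := soundP B C; last first.
  by rewrite (weight1_unsound _ _ _ sS h) (weight2_unsound _ _ _ sS h) !mul0r.
have [cl|op] := boolP (is_closed (bit B) (bit C) S); last first.
  by rewrite weight1_open ?weight2_open ?mul0r.
rewrite /weight1 /weight2 /row1 /row2 cl !mulr1 raw1_sound // raw2_sound //.
rewrite -!mulrA -!exprD; congr (_ * _ ^+ _).
have := coinv_inversions snd; rewrite [X in (_ = _ + X)%N]big1 ?addn0 // => a _.
by move/eqP: cl => ->; rewrite big1 // => b _; rewrite ffunE.
Qed.

(** Along a chain the row identities telescope, leaving the inversion numbers of the two ends. *)
Lemma chain_inversions j B :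
  chain n (weight1 t zs) j B * t ^+ inversions (bit (vacuum k S' n)) S =
  chain n (weight2 t zs) j B * t ^+ inversions (bit B) S.
Proof.
elim: j B => [|j IH] B /=; first by case: eqP => [->|_]; rewrite ?mul0r.
rewrite !big_distrl /=; apply: eq_bigr => C _.
by rewrite -[RHS]mulrA -weight_inversions mulrA mulrAC IH mulrAC -mulrA mulrAC mulrA.
Qed.
End ChainInversions.

(** * Partitions as particle configurations *)

Section Arrays.
Variables (k n : nat).
Local Notation K := 'I_k.+1.
Local Notation bits := (nat -> K -> bool).
Local Notation array := (K -> 'I_n -> nat).
Implicit Types (h : array) (c : K) (r : 'I_n).

Definition nonincreasing h := forall c r r', (r <= r')%N -> (h c r' <= h c r)%N.

Definition site h c r : nat := (h c r + (n - r.+1))%N.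

Lemma site_lt h c r r' : nonincreasing h -> (r < r')%N -> (site h c r' < site h c r)%N.
Proof.
move=> dh rr'; have := dh c r r' (ltnW rr'); rewrite /site.
have := ltn_ord r'; lia.
Qed.

Lemma site_inj h c : nonincreasing h -> injective (site h c).
Proof.
move=> dh r r' e; case: (ltngtP r r') => [lt|lt|/ord_inj //].
  by have := site_lt c dh lt; lia.
by have := site_lt c dh lt; lia.
Qed.

Definition bits_of h : bits := fun s c => [exists r, site h c r == s].

Lemma bits_ofE h s c : nonincreasing h ->
  (bits_of h s c : nat) = (\sum_r (site h c r == s))%N.
Proof.
move=> dh; rewrite /bits_of; case: existsP => [[r /eqP rs]|no]; last first.
  rewrite big1 // => r _; case: eqP => // e; case: no; exists r; exact/eqP.
rewrite (bigD1 r) //= rs eqxx big1 // => r' r'r; case: eqP => // e.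
by case/eqP: r'r; apply: (@site_inj h c dh); rewrite e rs.
Qed.

Lemma particles_of h c s : nonincreasing h ->
  particles (bits_of h) c s = (\sum_r (site h c r < s))%N.
Proof.
move=> dh; elim: s => [|s IH]; first by rewrite /particles big_ord0 big1.
rewrite particlesS IH (bits_ofE _ _ dh) -big_split; apply: eq_bigr => r _ /=.
by rewrite ltnS (leq_eqVlt (site h c r)); case: ltngtP.
Qed.

(** Sites decrease strictly with the row index, so row [r] lies left of [s] exactly when the [n - r]
    rows from [r] on all do. *)
Lemma particles_threshold h c r s : nonincreasing h ->
  (site h c r < s)%N = (n - r <= particles (bits_of h) c s)%N.
Proof.
move=> dh; rewrite particles_of //.
have card_ge : (\sum_(r' : 'I_n) (r <= r') = n - r)%N.
  rewrite -(big_mkord xpredT (fun i => (r <= i)%N : nat)) (@big_cat_nat _ _ _ r) //=; last exact: ltnW.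
  rewrite big1_seq ?add0n => [|i]; last first.
    by rewrite mem_index_iota /= ltnNge => /negPf->.
  rewrite (eq_big_nat _ _ (F2 := fun=> 1%N)) ?sum_nat_const_nat ?muln1 //.
  by move=> i /andP[->].
rewrite -card_ge; case: (ltnP (site h c r) s) => hs; apply/esym.
  apply: leq_sum => r' _; case: (leqP r r') => // rr'.
  by rewrite (leq_ltn_trans _ hs) // /site leq_add ?dh ?leq_sub2l.
apply/negbTE; rewrite -ltnNge (bigD1 r) //= [X in (_ < X)%N](bigD1 r) //=.
rewrite leqnn (_ : (site h c r < s)%N = false) ?add0n ?add1n ?ltnS; last by rewrite ltnNge hs.
apply: leq_sum => r' r'r.
case: (ltnP (site h c r') s) => //= hs'; rewrite (_ : (r <= r')%N) //.
by rewrite leqNgt; apply: contraTN hs' => /(site_lt c dh); lia.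
Qed.

(** The skew shape between [h] and [h'] is a horizontal strip. *)
Definition interlace h h' :=
  (forall c r, (h c r <= h' c r)%N) /\
  (forall c r r', r' = r.+1 :> nat -> (h' c r' <= h c r)%N).

Section Interlace.
Variables h h' : array.
Hypotheses (dh : nonincreasing h) (dh' : nonincreasing h') (ih : interlace h h').

(** Interlacing makes the intervals of sites swept by the rows of one colour disjoint; hence edges
    and visits can later be written as sums over rows. *)
Lemma interlace_uniq c r r' s : (site h c r <= s <= site h' c r)%N ->
  (site h c r' <= s <= site h' c r')%N -> r = r'.
Proof.
case: ih => _ ih2.
have aux (a b : 'I_n) : (a < b)%N -> (site h' c b < site h c a)%N.
  move=> ab; have an : (a.+1 < n)%N by apply: leq_ltn_trans ab (ltn_ord b).
  have := ih2 c a (Ordinal an) erefl; have := dh' c (r := Ordinal an) ab.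
  by rewrite /site /=; have := ltn_ord b; lia.
move=> /andP[p1 p2] /andP[p3 p4]; case: (ltngtP r r') => [/aux|/aux|/ord_inj //]; lia.
Qed.

Lemma edge_of s c :
  edge (bits_of h) (bits_of h') s c = [exists r, (site h c r < s <= site h' c r)%N].
Proof.
case: ih => ih1 _; elim: s => [|s IH].
  by rewrite ffunE; apply/esym/existsP => -[r]; rewrite ltn0.
have sh r : (site h c r <= site h' c r)%N by rewrite /site leq_add2r.
rewrite edgeS ffunE IH /bits_of; apply/andP/existsP => [[]|[r /andP[hr h'r]]].
  move=> pr; rewrite negb_exists => /forallP no.
  have [r /andP[r1 r2]] : exists r, (site h c r <= s <= site h' c r)%N.
    case/orP: pr => /existsP[r hr]; exists r; last by rewrite -(eqP hr) leqnn sh.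
    by case/andP: hr => /ltnW-> ->.
  by exists r; rewrite ltnS r1 ltn_neqAle r2 eq_sym no.
split.
  apply/orP; move: hr; rewrite ltnS leq_eqVlt => /orP[hr|hr]; [right|left];
    by apply/existsP; exists r => //; rewrite hr ltnW.
rewrite negb_exists; apply/forallP => r'; apply/eqP => e.
have rr' : r = r'.
  apply: (@interlace_uniq c _ _ s); first by rewrite -ltnS hr ltnW.
  by rewrite -e leqnn sh.
by move: h'r; rewrite rr' e ltnn.
Qed.

Lemma pres_of s c :
  pres (bits_of h) (bits_of h') s c = [exists r, (site h c r <= s <= site h' c r)%N].
Proof.
have sh r : (site h c r <= site h' c r)%N by case: ih => ih1 _; rewrite /site leq_add2r.
rewrite ffunE edge_of /bits_of; apply/orP/existsP => [[]/existsP[r hr]|[r /andP[]]].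
- by exists r; case/andP: hr => /ltnW-> ->.
- by exists r; rewrite -(eqP hr) leqnn sh.
by rewrite leq_eqVlt => /orP[hr|hr] hs; [right|left]; apply/existsP; exists r; rewrite hr.
Qed.

Lemma sound_of s c : sound (bits_of h) (bits_of h') s c.
Proof.
have sh r : (site h c r <= site h' c r)%N by case: ih => ih1 _; rewrite /site leq_add2r.
rewrite /sound pres_of edge_of; apply/andP; split.
  apply/negP => /andP[/existsP[r /andP[r1 r2]] /existsP[r' /eqP e]].
  have rr' : r = r'.
    by apply: (@interlace_uniq c _ _ s); rewrite ?(ltnW r1) // -e leqnn sh.
  by move: r1; rewrite rr' e ltnn.
apply/implyP => /existsP[r /eqP e]; apply/existsP; exists r.
by rewrite -e leqnn sh.
Qed.

Lemma edge_of_sum s c : (edge (bits_of h) (bits_of h') s.+1 c : nat) =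
  (\sum_r (site h c r <= s < site h' c r))%N.
Proof.
rewrite edge_of; case: existsP => [[r hr]|no]; last first.
  by rewrite big1 // => r _; apply/eqP; rewrite eqb0; apply/negP => hr; case: no; exists r.
rewrite (bigD1 r) //= -[(site h c r <= s)%N]ltnS hr big1 // => r' r'r; apply/eqP; rewrite eqb0.
apply: contra r'r => /andP[r1 r2]; apply/eqP/(@interlace_uniq c _ _ s).
  by rewrite r1 ltnW.
by case/andP: hr => r3 r4; rewrite -ltnS r3 ltnW.
Qed.

Lemma pres_of_sum s c : (pres (bits_of h) (bits_of h') s c : nat) =
  (\sum_r (site h c r <= s <= site h' c r))%N.
Proof.
rewrite pres_of; case: existsP => [[r hr]|no]; last first.
  by rewrite big1 // => r _; apply/eqP; rewrite eqb0; apply/negP => hr; case: no; exists r.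
rewrite (bigD1 r) //= hr big1 // => r' r'r; apply/eqP; rewrite eqb0.
by apply: contra r'r => hr'; apply/eqP/(@interlace_uniq c _ _ s).
Qed.
End Interlace.

Lemma interlace_of_sound h h' S : nonincreasing h -> nonincreasing h' ->
  (forall c r, (site h c r < S)%N) -> (forall c r, (site h' c r < S)%N) ->
  (forall s c, (s < S)%N -> sound (bits_of h) (bits_of h') s c) -> interlace h h'.
Proof.
move=> dh dh' hS h'S snd.
have ecnt s c : (s <= S)%N -> particles (bits_of h) c s =
    (particles (bits_of h') c s + edge (bits_of h) (bits_of h') s c)%N.
  by move=> sS; apply: edge_count => i iS; apply: snd; exact: leq_trans iS sS.
split=> [c r|c r r' e].
  suff : (site h c r < (site h' c r).+1)%N by rewrite ltnS /site leq_add2r.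
  rewrite (particles_threshold _ _ _ dh) ecnt // (leq_trans _ (leq_addr _ _)) //.
  by rewrite -(particles_threshold _ _ _ dh').
suff : (site h' c r' < site h c r)%N.
  by have := ltn_ord r'; rewrite /site e; lia.
rewrite (particles_threshold _ _ _ dh').
have : (n - r <= particles (bits_of h) c (site h c r).+1)%N.
  by rewrite -(particles_threshold _ _ _ dh).
rewrite particlesS ecnt; last exact: ltnW.
(* An arriving path and a particle starting at this site exclude each other, so together they
   account for at most one unit. *)
have := snd _ c (hS c r); rewrite /sound => /andP[+ _]; rewrite e subnS.
by case: (edge _ _ _ _); case: (bits_of h _ _) => //=; lia.
Qed.

Lemma bits_of_inj h h' S : nonincreasing h -> nonincreasing h' ->
  (forall c r, (site h c r < S)%N) -> (forall c r, (site h' c r < S)%N) ->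
  (forall s c, (s < S)%N -> bits_of h s c = bits_of h' s c) ->
  forall c r, h c r = h' c r.
Proof.
move=> dh dh' hS h'S e.
have le g g' : nonincreasing g -> nonincreasing g' -> (forall c r, (site g' c r < S)%N) ->
    (forall s c, (s < S)%N -> bits_of g s c = bits_of g' s c) ->
    forall c r, (g c r <= g' c r)%N.
  move=> dg dg' g'S e' c r.
  suff : (site g c r < (site g' c r).+1)%N by rewrite ltnS /site leq_add2r.
  rewrite (particles_threshold _ _ _ dg).
  rewrite [particles _ _ _](_ : _ = particles (bits_of g') c (site g' c r).+1).
    by rewrite -(particles_threshold _ _ _ dg').
  by apply: eq_bigr => i _; rewrite e' // (leq_trans (ltn_ord i)).
move=> c r; apply/eqP; rewrite eqn_leq (le h h') ?(le h' h) //.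
by move=> s c' sS; rewrite e.
Qed.

Lemma bits_of_surj (B : bits) S : (forall c, particles B c S = n) ->
  exists h, [/\ nonincreasing h, forall c r, (site h c r < S)%N
    & forall s c, (s < S)%N -> B s c = bits_of h s c].
Proof.
move=> cB; pose L c := [seq s <- iota 0 S | B s c].
have szL c : size (L c) = n.
  rewrite -(cB c) /particles -(big_mkord xpredT (fun i => B i c : nat)).
  by rewrite size_filter -sum1_count big_mkcond /= /index_iota subn0.
have ltL c i j : (i < j < n)%N -> (nth 0%N (L c) i < nth 0%N (L c) j)%N.
  move=> /andP[ij jn]; apply: (sorted_ltn_nth ltn_trans) => //.
  - exact: (sorted_filter ltn_trans _ (iota_ltn_sorted 0 S)).
  - by rewrite inE szL (ltn_trans ij).
  - by rewrite inE szL.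
have geL c i : (i < n)%N -> (i <= nth 0%N (L c) i)%N.
  elim: i => // i IH lt_in; apply: leq_ltn_trans (IH (ltnW lt_in)) (ltL c i i.+1 _).
  by rewrite leqnn.
(* [L c] increases while sites decrease with the row index, hence the reversal [n - r.+1]; by [geL]
   the subtraction does not truncate. *)
pose h c (r : 'I_n) := (nth 0%N (L c) (n - r.+1) - (n - r.+1))%N.
have lt_rev (r : 'I_n) : (n - r.+1 < n)%N by have := ltn_ord r; lia.
have siteE c r : site h c r = nth 0%N (L c) (n - r.+1).
  by rewrite /site /h subnK // geL.
exists h; split.
- move=> c r r' rr'.
  suff : (site h c r' + (r' - r) <= site h c r)%N.
    by have := ltn_ord r'; rewrite /site; lia.
  rewrite !siteE; move: (lt_rev r) (lt_rev r').
  have -> : (n - r.+1 = n - r'.+1 + (r' - r))%N by have := ltn_ord r'; lia.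
  elim: (r' - r)%N => [|d IH] p1 p2; first by rewrite !addn0.
  have p3 : (n - r'.+1 + d < n)%N by lia.
  have p4 : (n - r'.+1 + d < n - r'.+1 + d.+1 < n)%N by rewrite p1 andbT; lia.
  have := IH p3 p2; have := ltL c _ _ p4; lia.
- move=> c r; rewrite siteE.
  have : nth 0%N (L c) (n - r.+1) \in L c by rewrite mem_nth // szL.
  by rewrite mem_filter mem_iota => /andP[_ /andP[]].
move=> s c sS; apply/idP/existsP => [Bs|[r]]; last first.
  rewrite siteE => /eqP <-.
  have : nth 0%N (L c) (n - r.+1) \in L c by rewrite mem_nth // szL.
  by rewrite mem_filter => /andP[].
have sL : s \in L c by rewrite mem_filter Bs mem_iota.
have iL : (index s (L c) < n)%N by rewrite -(szL c) index_mem.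
have rn : (n - (index s (L c)).+1 < n)%N by lia.
exists (Ordinal rn); rewrite siteE /=.
by rewrite (_ : n - _ = index s (L c))%N ?nth_index //; lia.
Qed.
End Arrays.

(** * Tableaux as chains of configurations *)

(** A set of indices closed downwards is the initial segment whose length is its cardinality. *)
Lemma sum_initial (f : nat -> bool) p j : (forall i i', (i <= i')%N -> f i' -> f i) ->
  (forall i, f i -> (i < p)%N) -> (j < \sum_(i < p) f i)%N = f j.
Proof.
move=> f_mono f_lt; rewrite -(big_mkord xpredT (fun i => f i : nat)).
have [fj|nfj] := boolP (f j).
  rewrite (@big_cat_nat _ _ _ j.+1) //= ?f_lt //.
  rewrite (eq_big_nat _ _ (F2 := fun=> 1%N)); last first.
    by move=> i /andP[_ ij]; rewrite (f_mono _ j).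
  by rewrite sum_nat_const_nat subn0 muln1 ltnS leq_addr.
apply/negbTE; rewrite -leqNgt; have [pj|jp] := leqP p j.
  apply: leq_trans pj; rewrite big_mkord -[X in (_ <= X)%N]card_ord -sum1_card.
  by apply: leq_sum => i _; case: (f i).
rewrite (@big_cat_nat _ _ _ j) //=; last exact: ltnW.
rewrite [X in (_ + X)%N]big1_seq ?addn0 => [|i]; last first.
  rewrite mem_index_iota /= => /andP[ji _]; apply/eqP; rewrite eqb0.
  by apply: contra nfj; apply: f_mono.
rewrite big_mkord -[X in (_ <= X)%N]card_ord -sum1_card.
by apply: leq_sum => i _; case: (f i).
Qed.

Lemma part_nonincreasing n k (la : mpartition n k.+1) : nonincreasing (part la).
Proof.
move=> c r r' rr'; rewrite /part !(tnth_nth 0%N).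
case: (la c) => [[s /= sz] srt] /=; move: (eqP sz) => {}sz.
apply: (sorted_leq_nth (leT := geq)) => //.
- by move=> a b d /= h1 h2; apply: leq_trans h2 h1.
- by move=> a /=.
- by rewrite inE sz.
- by rewrite inE sz.
Qed.

Lemma sum_tagged (I : finType) (J : I -> finType) (G : {i : I & J i} -> nat) :
  (\sum_u G u = \sum_(i : I) \sum_(j : J i) G (Tagged J j))%N.
Proof. by rewrite sig_big_dep /=; apply: eq_bigr => -[i j]. Qed.

Section Tableaux.
Variables (n k S' : nat) (la : mpartition n k.+1).
Local Notation K := 'I_k.+1.
Local Notation S := S'.+1.
Local Notation conf := (conf k S').
Local Notation array := (K -> 'I_n -> nat).
Implicit Types (T : filling la) (a c : K).

Hypothesis la_le : forall c r, (part la c r + n <= S)%N.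

Definition mkcell c (r : 'I_n) (j : 'I_(part la c r)) : cell la :=
  Tagged (fun p : K * 'I_n => 'I_(part la p.1 p.2)) (i := (c, r)) j.

Lemma sum_cell (G : cell la -> nat) :
  (\sum_u G u = \sum_(c : K) \sum_(r : 'I_n) \sum_(j < part la c r) G (mkcell j))%N.
Proof. by rewrite sum_tagged pair_bigA; apply: eq_bigr => -[c r] _. Qed.

(* Positions outside the shape get the value [n], one more than the largest
   entry. *)
Definition tval T c (r : 'I_n) (j : nat) : nat :=
  if insub j is Some j' then T (@mkcell c r j') else n.

Lemma tvalE T c (r : 'I_n) (j : 'I_(part la c r)) : tval T c r j = T (mkcell j).
Proof. by rewrite /tval valK. Qed.

Lemma tval_out T c (r : 'I_n) j : (part la c r <= j)%N -> tval T c r j = n.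
Proof. by move=> h; rewrite /tval insubF // ltnNge h. Qed.

Lemma tval_lt T c (r : 'I_n) j : (tval T c r j < n)%N = (j < part la c r)%N.
Proof.
have [lt|ge] := ltnP j (part la c r); last by rewrite tval_out // ltnn.
by rewrite (tvalE T (Ordinal lt)) ltn_ord.
Qed.

Lemma entryE T c (r : 'I_n) j :
  entry T (c, r) j.+1 = if (j < part la c r)%N then Some (tval T c r j).+1 else None.
Proof.
rewrite /entry /tval; case: insubP => [u -> _|/negPf -> //].
by [].
Qed.

Lemma tableauP T : is_tableau T <->
  (forall c r j j', (j <= j')%N -> (tval T c r j <= tval T c r j')%N) /\
  (forall c (r r' : 'I_n) j, (r < r')%N -> (j < part la c r')%N ->
     (tval T c r j < tval T c r' j)%N).
Proof.
split=> [/forallP tab|[hr hc]].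
  have rel (c : K) r r' (u : 'I_(part la c r)) (v : 'I_(part la c r')) :=
    implyP (forallP (tab (mkcell u)) (mkcell v)) (eqxx c).
  split=> [c r j j' jj'|c r r' j rr' jp].
    have [lt'|ge'] := ltnP j' (part la c r); last first.
      rewrite (tval_out _ ge'); have [lt|ge] := ltnP j (part la c r).
        by apply: ltnW; rewrite tval_lt.
      by rewrite tval_out.
    have lt := leq_ltn_trans jj' lt'.
    rewrite (tvalE T (Ordinal lt)) (tvalE T (Ordinal lt')).
    have /andP[/implyP h _] := rel c r r (Ordinal lt) (Ordinal lt').
    by apply: h; rewrite /Defs.row /Defs.col eqxx /= ltnS.
  have lt : (j < part la c r)%N.
    by apply: leq_trans jp _; apply: part_nonincreasing; exact: ltnW.
  rewrite (tvalE T (Ordinal lt)) (tvalE T (Ordinal jp)).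
  have /andP[_ /implyP h] := rel c r r' (Ordinal lt) (Ordinal jp).
  by apply: h; rewrite /Defs.row /Defs.col eqxx /= ltnS.
apply/forallP => -[[c r] u]; apply/forallP => -[[c' r'] v]; apply/implyP => /= /eqP e.
case: c' / e v => v; rewrite /Defs.row /Defs.col /=; apply/andP; split; apply/implyP => /andP[].
  rewrite eqSS ltnS => /eqP/ord_inj e; case: r' / e v => v uv.
  by have := hr c r _ _ uv; rewrite !tvalE.
rewrite eqSS ltnS => /eqP uv rr'.
by have := hc c r r' v rr' (ltn_ord v); rewrite tvalE -uv tvalE.
Qed.

(** Row lengths of the part of the shape filled with entries less than [i], entries being counted
    from 0. *)
Definition subshape T (i : nat) : array :=
  fun c r => (\sum_(j < part la c r) (tval T c r j < i))%N.

Section OneTableau.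
Variable T : filling la.
Hypothesis tab : is_tableau T.

Lemma subshapeE i c r j : (i <= n)%N -> (j < subshape T i c r)%N = (tval T c r j < i)%N.
Proof.
move=> le_in; apply: (sum_initial (f := fun j => (tval T c r j < i)%N)).
  by case/tableauP: tab => h _ j1 j2 /(h c r); apply: leq_ltn_trans.
by move=> j1 lt; rewrite -(tval_lt T) (leq_trans lt).
Qed.

Lemma subshape0 c r : subshape T 0 c r = 0%N.
Proof. by rewrite /subshape big1. Qed.

Lemma subshapen c r : subshape T n c r = part la c r.
Proof.
rewrite /subshape -[RHS]card_ord -sum1_card; apply: eq_bigr => j _.
by rewrite tval_lt ltn_ord.
Qed.

Lemma subshape_le i c r : (subshape T i c r <= part la c r)%N.
Proof.
rewrite /subshape -[X in (_ <= X)%N]card_ord -sum1_card; apply: leq_sum => j _.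
by case: (_ < _)%N.
Qed.

Lemma subshape_nonincreasing i : (i <= n)%N -> nonincreasing (subshape T i).
Proof.
move=> le_in c r r' rr'; case: (ltngtP r r') rr' => // [rr' _|/ord_inj-> //].
rewrite leqNgt; apply/negP => lt; have := ltnn (subshape T i c r).
move: lt; rewrite !subshapeE // => lt.
have jp : (subshape T i c r < part la c r')%N by rewrite -(tval_lt T) (leq_trans lt).
case/tableauP: tab => _ /(_ c r r' _ rr' jp) /ltn_trans /(_ lt) ->.
by [].
Qed.

Lemma subshape_interlace i : (i < n)%N -> interlace (subshape T i) (subshape T i.+1).
Proof.
move=> lt_in; split=> [c r|c r r' e].
  apply: leq_sum => j _; by case: (ltnP _ i) => // lt; rewrite ltnS (ltnW lt).
rewrite leqNgt; apply/negP => lt; have := ltnn (subshape T i c r).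
move: lt; rewrite !subshapeE //; last exact: ltnW.
move=> lt; have jp : (subshape T i c r < part la c r')%N by rewrite -(tval_lt T) (leq_trans lt).
have rr' : (r < r')%N by rewrite e.
case/tableauP: tab => _ /(_ c r r' _ rr' jp) lt2.
by rewrite (leq_trans lt2).
Qed.

Lemma site_subshape i c r : (site (subshape T i) c r < S)%N.
Proof.
have := subshape_le i c r; have := la_le c r; have := ltn_ord r; rewrite /site; lia.
Qed.

Lemma sum_window m p (F : nat -> nat) : (m + p <= S)%N ->
  (forall s, ~~ (m <= s < m + p)%N -> F s = 0%N) ->
  (\sum_(s < S) F s = \sum_(j < p) F (j + m)%N)%N.
Proof.
move=> le F0; rewrite -(big_mkord xpredT F).
rewrite (@big_cat_nat _ _ _ m) //=; last by lia.
rewrite (@big_cat_nat _ _ _ (m + p) m) //=; last by lia.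
rewrite big1_seq ?add0n => [|s]; last first.
  by rewrite mem_index_iota /= => sm; apply: F0; lia.
rewrite [X in (_ + X)%N]big1_seq ?addn0 => [|s]; last first.
  by rewrite mem_index_iota /= => sm; apply: F0; lia.
by rewrite -{1}[m]add0n big_addn addKn big_mkord.
Qed.

(** Each cell corresponds to one step of a path, made in the row of its entry and starting at the
    site equal to its content plus [n - 1]. *)
Lemma sum_cells (F : 'I_n -> nat -> K -> 'I_n -> nat) :
  (\sum_(i < n) \sum_(s < S) \sum_(c : K) \sum_(r : 'I_n)
     (site (subshape T i) c r <= s < site (subshape T i.+1) c r) * F i s c r =
   \sum_(u : cell la) F (T u) (tagged u + (n - (tag u).2.+1)) (tag u).1 (tag u).2)%N.
Proof.
rewrite sum_cell /=.
under eq_bigr do rewrite exchange_big /=.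
rewrite exchange_big /=; apply: eq_bigr => c _.
under eq_bigr do rewrite exchange_big /=.
rewrite exchange_big /=; apply: eq_bigr => r _.
rewrite exchange_big /= (@sum_window (n - r.+1) (part la c r) (fun s =>
  \sum_(i < n) (site (subshape T i) c r <= s < site (subshape T i.+1) c r) * F i s c r)%N).
- apply: eq_bigr => j _; rewrite (bigD1 (T (mkcell j))) //= big1 ?addn0 => [|i ne].
    rewrite -tvalE /site leq_add2r ltn_add2r leqNgt !subshapeE ?ltnn ?ltnSn ?mul1n //.
      by rewrite tval_lt.
    by rewrite ltnW // tval_lt.
  rewrite /site leq_add2r ltn_add2r leqNgt !subshapeE // ?tvalE; last exact: ltnW.
  rewrite -leqNgt ltnS -eqn_leq; case: eqP => // /ord_inj e.
  by rewrite e eqxx in ne.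
- by have := la_le c r; have := ltn_ord r; lia.
move=> s out; rewrite big1 // => i _; case: andP => // -[h1 h2]; case/negP: out.
by have := subshape_le i.+1 c r; move: h1 h2; rewrite /site; lia.
Qed.
End OneTableau.
End Tableaux.

Section ConfOf.
Variables (n k S' : nat).
Local Notation K := 'I_k.+1.
Local Notation S := S'.+1.
Local Notation array := (K -> 'I_n -> nat).
Implicit Types h : array.

Definition conf_of h : conf k S' := mkconf S' (bits_of h).

Lemma bit_conf_of h : (forall c r, (site h c r < S)%N) -> bit (conf_of h) = bits_of h.
Proof.
move=> hS; apply/funext => s; apply/funext => c.
have [sS|Ss] := ltnP s S; first exact: bit_mkconf.
rewrite bit_out //; apply/esym/existsP => -[r /eqP e].
by have := hS c r; rewrite e ltnNge Ss.
Qed.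

Lemma conf_of0 : conf_of (fun _ _ => 0%N) = vacuum k S' n.
Proof.
congr mkconf; apply/funext => s; apply/funext => c; rewrite /bits_of /packed /site.
apply/existsP/idP => [[r /eqP]|sn]; first by have := ltn_ord r; lia.
have rn : (n - s.+1 < n)%N by lia.
by exists (Ordinal rn) => /=; apply/eqP; lia.
Qed.

Lemma eq_conf_of h h' : (forall c r, h c r = h' c r) -> conf_of h = conf_of h'.
Proof. by move=> e; congr (conf_of _); apply/funext => c; apply/funext => r. Qed.

Lemma conf_of_inj h h' : nonincreasing h -> nonincreasing h' ->
  (forall c r, (site h c r < S)%N) -> (forall c r, (site h' c r < S)%N) ->
  conf_of h = conf_of h' -> forall c r, h c r = h' c r.
Proof.
move=> dh dh' hS h'S e; apply: (bits_of_inj dh dh' hS h'S) => s c _.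
by rewrite -bit_conf_of // e bit_conf_of.
Qed.
End ConfOf.

Section ChainWords.
Variables (k S' n : nat) (A : comNzRingType).
Local Notation conf := (conf k S').
Local Notation vac := (vacuum k S' n).
Variable r : nat -> conf -> conf -> A.

Lemma chain_words m w : chain n r m w = \sum_(u : m.-tuple conf)
  (\prod_(i < m) r i (nth vac (vac :: u) i) (nth vac (vac :: u) i.+1)) *
  (nth vac (vac :: u) m == w)%:R.
Proof.
have runE (f : seq conf) i : run (fun _ _ b => b) vac (nth vac f) i = nth vac (vac :: f) i.
  by case: i.
transitivity (transfer (fun _ _ b => b) r vac m (fun s => (s == w)%:R)).
  elim: m w => [|m IH] w /=; first by rewrite eq_sym.
  rewrite (eq_bigr (fun B => r m B w * transfer (fun _ _ b => b) r vac m (fun s => (s == B)%:R))).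
    rewrite -transfer_sum; apply: eq_transfer => s.
    rewrite (bigD1 s) //= eqxx big1 ?addr0 => [|B /negPf]; last by rewrite eq_sym => ->; rewrite mulr0.
    rewrite (bigD1 w) //= eqxx mulr1 big1 ?addr0 ?mulr1 // => B /negPf->.
    by rewrite mulr0.
  by move=> B _; rewrite IH mulrC.
rewrite (transferE _ _ _ vac); apply: eq_bigr => u _; rewrite runE; congr (_ * _).
by apply: eq_bigr => i _; rewrite runE.
Qed.
End ChainWords.

(** * The bijection between tableaux and chains *)

Section LLTChain.
Variables (n k S' : nat) (la : mpartition n k.+1).
Local Notation K := 'I_k.+1.
Local Notation S := S'.+1.
Local Notation conf := (conf k S').
Local Notation vac := (vacuum k S' n).
Local Notation array := (K -> 'I_n -> nat).

Hypothesis n_gt0 : (0 < n)%N.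
Hypothesis n_le : (n <= S)%N.
Hypothesis la_le : forall c r, (part la c r + n <= S)%N.

Definition tableau_word (T : filling la) : n.-tuple conf :=
  [tuple conf_of S' (subshape T i.+1) | i < n].

Lemma nth_tableau_word T i : (i <= n)%N ->
  nth vac (vac :: tableau_word T) i = conf_of S' (subshape T i).
Proof.
case: i => [_|i lt].
  by rewrite -conf_of0; apply: eq_conf_of => c r; rewrite subshape0.
by rewrite -[LHS]/(nth vac (tableau_word T) (Ordinal lt)) -tnth_nth tnth_mktuple.
Qed.

Lemma tableau_word_inj : {in @is_tableau n k.+1 la &, injective tableau_word}.
Proof.
move=> T T' tab tab' e; apply/ffunP => -[[c r] j].
have sE i : (i <= n)%N -> subshape T i c r = subshape T' i c r.
  move=> le_in; apply: (@conf_of_inj n k S').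
  - exact: subshape_nonincreasing.
  - exact: subshape_nonincreasing.
  - exact: site_subshape.
  - exact: site_subshape.
  by rewrite -!nth_tableau_word // e.
have vE i : (i <= n)%N -> (T (mkcell j) < i)%N = (T' (mkcell j) < i)%N.
  by move=> le_in; rewrite -!tvalE -!subshapeE // sE.
apply: ord_inj; apply/eqP; rewrite eqn_leq -[X in X && _]ltnS -[X in _ && X]ltnS.
by rewrite vE ?ltn_ord // ltnSn -vE ?ltn_ord // ltnSn.
Qed.

Section Surjectivity.
Variable u : n.-tuple conf.
Local Notation C i := (nth vac (vac :: u) i).
Hypothesis snd : forall i s c, (i < n)%N -> (s < S)%N ->
  sound (bit (C i)) (bit (C i.+1)) s c.
Hypothesis cl : forall i, (i < n)%N -> is_closed (bit (C i)) (bit (C i.+1)) S.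
Hypothesis last_u : C n = conf_of S' (part la).

Lemma particles_word i c : (i <= n)%N -> particles (bit (C i)) c S = n.
Proof.
elim: i => [|i IH] le_in.
  transitivity (particles (@packed k n) c S); last by rewrite particles_packed (minn_idPr n_le).
  by apply: eq_bigr => j _; rewrite bit_vacuum.
apply: etrans (IH (ltnW le_in)); apply: esym.
rewrite (@edge_count _ (bit (C i)) (bit (C i.+1))) => [|j jS]; last exact: snd.
by have /eqP-> := cl le_in; rewrite ffunE addn0.
Qed.

Lemma word_shapes : exists h : nat -> array, forall i, (i <= n)%N ->
  [/\ nonincreasing (h i), forall c r, (site (h i) c r < S)%N & C i = conf_of S' (h i)].
Proof.
have ex i : exists h : array, (i <= n)%N ->
    [/\ nonincreasing h, forall c r, (site h c r < S)%N & C i = conf_of S' h].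
  have [le_in|lt_ni] := leqP i n; last by exists (fun _ _ => 0%N).
  have [h [dh hS hE]] := bits_of_surj (fun c => particles_word c le_in).
  exists h => _; split=> //; apply: conf_eq => s c sS.
  by rewrite (bit_conf_of hS) hE.
by have [h hP] := choice ex; exists h.
Qed.

Lemma tableau_word_surj : exists2 T : filling la, is_tableau T & tableau_word T = u.
Proof.
have [h hP] := word_shapes.
have dh i : (i <= n)%N -> nonincreasing (h i) by case/hP.
have hS i : (i <= n)%N -> forall c r, (site (h i) c r < S)%N by case/hP.
have hE i : (i <= n)%N -> C i = conf_of S' (h i) by case/hP.
have laS c r : (site (part la) c r < S)%N.
  by have := la_le c r; have := ltn_ord r; rewrite /site; lia.
have h0 c r : h 0%N c r = 0%N.
  apply: (@conf_of_inj n k S' (h 0%N) (fun _ _ => 0%N)) => //; first exact: dh.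
  - exact: hS.
  - by move=> c' r'; rewrite /site; have := ltn_ord r'; lia.
  by rewrite -hE // conf_of0.
have hn c r : h n c r = part la c r.
  apply: (@conf_of_inj n k S' (h n) (part la)) => //; first exact: dh.
  - exact: part_nonincreasing.
  - exact: hS.
  by rewrite -hE // last_u.
have ih i : (i < n)%N -> interlace (h i) (h i.+1).
  move=> lt_in; have le_in := ltnW lt_in.
  apply: (@interlace_of_sound k n _ _ S) => [||||s c sS].
  - exact: dh.
  - exact: dh.
  - exact: hS.
  - exact: hS.
  rewrite -(bit_conf_of (hS _ le_in)) -(bit_conf_of (hS _ lt_in)) -!hE //.
  exact: snd.
have h_mono i i' c r : (i <= i')%N -> (i' <= n)%N -> (h i c r <= h i' c r)%N.
  move=> ii'; rewrite -(subnKC ii'); elim: (i' - i)%N => [|d IH]; first by rewrite addn0.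
  rewrite addnS => lt; apply: leq_trans (IH (ltnW lt)) _.
  by have [+ _] := ih _ lt; apply.
(* The entry of a cell is the number of shapes, the initial one excepted, that do not yet contain
   it. *)
pose v c (r : 'I_n) (j : nat) := (\sum_(i < n) (h i.+1 c r <= j)%N)%N.
have vP c r j i : (j < part la c r)%N -> (i < n)%N -> (i < v c r j)%N = (h i.+1 c r <= j)%N.
  move=> jp lt_in; pose f i := (i < n)%N && (h i.+1 c r <= j)%N.
  have -> : v c r j = (\sum_(i < n) f i)%N by apply: eq_bigr => i' _; rewrite /f ltn_ord.
  rewrite (sum_initial (f := f)) /f ?lt_in // => [i1 i2 le12 /andP[lt2 le2]|i1 /andP[]//].
  rewrite (leq_ltn_trans le12) //= (leq_trans _ le2) // h_mono //.
have v_lt c r j : (j < part la c r)%N -> (v c r j < n)%N.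
  move=> jp; have pn : (n.-1 < n)%N by rewrite prednK.
  have := vP c r j n.-1 jp pn; rewrite prednK // hn [(part la c r <= j)%N]leqNgt jp /= => /negbT.
  by rewrite -ltnNge.
pose T : filling la := [ffun w : cell la =>
  insubd (Ordinal n_gt0) (v (tag w).1 (tag w).2 (tagged w))].
have TE c r j : (j < part la c r)%N -> tval T c r j = v c r j.
  by move=> jp; rewrite (tvalE T (Ordinal jp)) ffunE /= val_insubd v_lt.
have tab : is_tableau T.
  apply/tableauP; split=> [c r j j' jj'|c r r' j rr' jp'].
    have [lt'|ge'] := ltnP j' (part la c r); last first.
      rewrite (tval_out _ ge'); have [lt|ge] := ltnP j (part la c r).
        by apply: ltnW; rewrite tval_lt.
      by rewrite tval_out.
    rewrite !TE //; last exact: leq_ltn_trans lt'.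
    by apply: leq_sum => i _; case: (leqP (h i.+1 c r) j) => // le; rewrite (leq_trans le).
  have jp : (j < part la c r)%N.
    by apply: leq_trans jp' _; apply: part_nonincreasing; exact: ltnW.
  rewrite !TE //; set w := v c r' j; have wn : (w < n)%N by exact: v_lt.
  (* The cell in row [r'] is present after step [w]. By interlacing, the cell of the same column in
     row [r] was present before that step, so its entry is smaller. *)
  have := vP c r' j w jp' wn; rewrite ltnn => /esym/negbT; rewrite -ltnNge => lt_h.
  have r1n : (r.+1 < n)%N by apply: leq_ltn_trans rr' (ltn_ord r').
  have [_ il] := ih _ wn.
  have lt_hr : (j < h w c r)%N.
    apply: leq_trans (il c r (Ordinal r1n) erefl); apply: leq_trans lt_h _.
    by apply: dh.
  case: (w) lt_hr wn => [|w']; first by rewrite h0.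
  move=> lt_hr w'n; rewrite ltnS leqNgt vP ?(ltnW w'n) // -ltnNge.
  by [].
exists T => //; apply: eq_from_tnth => i; rewrite tnth_mktuple (tnth_nth vac).
rewrite -[RHS]/(C i.+1) hE //; apply: eq_conf_of => c r.
rewrite /subshape (eq_bigr (fun j : 'I_(part la c r) => (j < h i.+1 c r)%N : nat)); last first.
  move=> j _; rewrite TE // ltnS leqNgt vP // -ltnNge.
  by [].
have le_h : (h i.+1 c r <= part la c r)%N by rewrite -hn h_mono.
rewrite -(big_mkord xpredT (fun j => (j < h i.+1 c r)%N : nat)) (@big_cat_nat _ _ _ (h i.+1 c r)) //=.
rewrite (eq_big_nat _ _ (F2 := fun=> 1%N)); last by move=> j /andP[_ ->].
rewrite sum_nat_const_nat subn0 muln1 big1_seq ?addn0 // => j.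
by rewrite mem_index_iota /= => /andP[le _]; rewrite ltnNge le.
Qed.
End Surjectivity.
End LLTChain.

Lemma content_site (n r r' j j' : nat) : (r < n)%N -> (r' < n)%N ->
  (j'.+1%:Z - r.+1%:Z == j.+1%:Z - r'.+1%:Z) = (j' + (n - r.+1) == j + (n - r'.+1))%N.
Proof. move=> rn r'n; apply/eqP/eqP; lia. Qed.

Local Arguments entry [n k la] T p c : simpl never.

(** * Coinversion triples as crossings of paths *)

Section LLTWeights.
Variables (n k S' : nat) (la : mpartition n k.+1).
Local Notation K := 'I_k.+1.
Local Notation S := S'.+1.
Local Notation conf := (conf k S').
Local Notation vac := (vacuum k S' n).

Hypothesis n_gt0 : (0 < n)%N.
Hypothesis n_le : (n <= S)%N.
Hypothesis la_le : forall c r, (part la c r + n <= S)%N.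

Section OneTableau.
Variable T : filling la.
Hypothesis tab : is_tableau T.

Local Notation B i := (bits_of (subshape T i)).

Lemma subshape_edges (i : 'I_n) :
  (\sum_(s < S) \sum_(c : K) edge (B i) (B i.+1) s.+1 c = \sum_u (T u == i))%N.
Proof.
transitivity (\sum_(i' < n) \sum_(s < S) \sum_(c : K) \sum_(r : 'I_n)
   (site (subshape T i') c r <= s < site (subshape T i'.+1) c r) * (i' == i))%N; last first.
  by rewrite (sum_cells la_le tab (fun i' _ _ _ => nat_of_bool (i' == i))).
rewrite [RHS](bigD1 i) //= [X in (_ = _ + X)%N]big1 ?addn0 => [|i' /negPf ne]; last first.
  rewrite big1 // => s _; rewrite big1 // => c _; rewrite big1 // => r _.
  by rewrite ne muln0.
apply: eq_bigr => s _; apply: eq_bigr => c _.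
have d1 : nonincreasing (subshape T i) by apply: subshape_nonincreasing => //; exact: ltnW.
have d2 : nonincreasing (subshape T i.+1) by apply: subshape_nonincreasing.
rewrite (edge_of_sum d2 (subshape_interlace tab (ltn_ord i))).
by apply: eq_bigr => r _; rewrite eqxx muln1.
Qed.

(** Equality of contents leaves at most one [w] in a given row. With [i] the entry of [v], the two
    inequalities say that [w] lies outside the shape of entries below [i], while [u], if it is a
    cell, lies inside the shape of entries at most [i]. So the path of that row visits the site of
    [v]. *)
Lemma coinv_condition (v : cell la) b (r : 'I_n) :
  (\sum_(j < (part la b r).+1) (is_triple v (Tagged (fun p : K * 'I_n => 'I_(part la p.1 p.2).+1)
       (i := (b, r)) j) &&
     is_coinversion T v (Tagged (fun p : K * 'I_n => 'I_(part la p.1 p.2).+1) (i := (b, r)) j)) =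
   ((tag v).1 < b) *
     (site (subshape T (T v)) b r <= tagged v + (n - (tag v).2.+1)
        <= site (subshape T (T v).+1) b r))%N.
Proof.
case: v => -[a r'] j /=; rewrite /is_triple /=.
case ab: (a < b)%N; last by rewrite big1.
rewrite mul1n; set i := T _; have lt_in : (i < n)%N by exact: ltn_ord.
have cond (j' : 'I_(part la b r).+1) :
  is_coinversion T (Tagged (fun p : K * 'I_n => 'I_(part la p.1 p.2)) (i := (a, r')) j)
     (Tagged (fun p : K * 'I_n => 'I_(part la p.1 p.2).+1) (i := (b, r)) j') =
  (subshape T i b r <= j' <= subshape T i.+1 b r)%N.
  rewrite /is_coinversion /Defs.xcol /= -/i entryE andbC; congr (_ && _).
    rewrite [RHS]leqNgt subshapeE //; last exact: ltnW.
    case: ifP => [_|/negbT]; first by rewrite -leqNgt ltnS.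
    by rewrite -leqNgt => out; rewrite (tval_out _ out) -leqNgt ltnW.
  case: j' => -[|j'] /= lt; first by rewrite leq0n.
  rewrite entryE ifT // subshapeE //=.
under eq_bigr => j' _ do rewrite cond /xcontent /content /Defs.xcol /Defs.xrow
  /Defs.col /Defs.row /= (content_site _ _ (ltn_ord r) (ltn_ord r')).
set s := (j + _)%N.
have [/andP[ge lt]|out] := boolP (n - r.+1 <= s < n - r.+1 + (part la b r).+1)%N.
  have j0p : (s - (n - r.+1) < (part la b r).+1)%N by rewrite ltn_subLR.
  rewrite (bigD1 (Ordinal j0p)) //= subnK // eqxx big1 ?addn0 => [|j' ne].
    by rewrite /site -{3 4}(subnK ge) !leq_add2r.
  case: eqP => //= e; case/eqP: ne; apply: ord_inj => /=.
  by rewrite -e addnK.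
rewrite big1 => [|j' _].
  apply/esym/eqP; rewrite eqb0; apply: contra out => /andP[h1 h2].
  have := subshape_le T i.+1 b r; move: h1 h2; rewrite /site.
  move: (subshape _ _ _ _) (subshape _ _ _ _) (part _ _ _) => h1 h2 p; lia.
case: eqP => //= e; case/negP: out; rewrite -e leq_addl /= addnC ltn_add2l.
exact: ltn_ord.
Qed.

Lemma coinv_subshape : (\sum_(i < n) coinv1 (B i) (B i.+1) S = coinv T)%N.
Proof.
pose F (i : 'I_n) s (c : K) (r : 'I_n) := (\sum_(b : K | c < b) \sum_(r' : 'I_n)
   (site (subshape T i) b r' <= s <= site (subshape T i.+1) b r'))%N.
transitivity (\sum_u F (T u) (tagged u + (n - (tag u).2.+1)) (tag u).1 (tag u).2)%N.
  rewrite -(sum_cells la_le tab F); apply: eq_bigr => i _; apply: eq_bigr => s _.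
  apply: eq_bigr => c _.
  have d1 : nonincreasing (subshape T i) by apply: subshape_nonincreasing => //; exact: ltnW.
  have d2 : nonincreasing (subshape T i.+1) by apply: subshape_nonincreasing.
  have il := subshape_interlace tab (ltn_ord i).
  rewrite (edge_of_sum d2 il) big_distrl /=; apply: eq_bigr => r _.
  congr (_ * _)%N; apply: eq_bigr => b _.
  by rewrite (pres_of_sum d2 il).
rewrite /coinv -sum1dep_card [RHS]big_mkcond /=.
rewrite -(pair_bigA _ (fun v w => if is_triple v w && is_coinversion T v w then 1 else 0)%N) /=.
apply: eq_bigr => v _; rewrite sum_tagged.
transitivity (\sum_(b : K) \sum_(r' : 'I_n) ((tag v).1 < b) *
     (site (subshape T (T v)) b r' <= tagged v + (n - (tag v).2.+1)
        <= site (subshape T (T v).+1) b r'))%N.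
  rewrite /F big_mkcond /=; apply: eq_bigr => b _; case: (_ < b)%N.
    by apply: eq_bigr => r' _; rewrite mul1n.
  by rewrite big1.
rewrite pair_bigA /=; apply: eq_bigr => -[b r'] _ /=.
by rewrite -coinv_condition.
Qed.
End OneTableau.

Variables (A : comNzRingType) (t : A) (x : 'I_n -> A) (xs : nat -> A).
Hypothesis xsE : forall i : 'I_n, xs i = x i.

Lemma tableau_word_weight (T : filling la) : is_tableau T ->
  \prod_(i < n) weight1 t xs i (nth vac (vac :: tableau_word S' T) i)
                               (nth vac (vac :: tableau_word S' T) i.+1) =
  t ^+ coinv T * \prod_(u : cell la) x (T u).
Proof.
move=> tab.
have -> : \prod_(u : cell la) x (T u) = \prod_(i < n) x i ^+ (\sum_u (T u == i))%N.
  rewrite (partition_big T xpredT) //=; apply: eq_bigr => i _.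
  rewrite (eq_bigr (fun=> x i)) => [|u /eqP-> //].
  by rewrite prodr_const -sum1_card [in RHS]big_mkcond /= -big_mkcond /= sum1_card.
rewrite -coinv_subshape // expr_sum mulrC -big_split; apply: eq_bigr => i _; rewrite [RHS]/=.
have lt_in := ltn_ord i; have le_in := ltnW lt_in.
rewrite !nth_tableau_word // /weight1 /row1 !bit_conf_of; try exact: site_subshape.
have d1 : nonincreasing (subshape T i) by apply: subshape_nonincreasing.
have d2 : nonincreasing (subshape T i.+1) by apply: subshape_nonincreasing.
have il := subshape_interlace tab lt_in.
rewrite raw1_sound => [|s c _]; last exact: (sound_of d2 il).
rewrite subshape_edges // xsE (_ : is_closed _ _ _ = true) ?mulr1 //.
apply/eqP/ffunP => c; rewrite (edge_of d2 il) [RHS]ffunE.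
apply/existsP => -[r /andP[_]].
by rewrite leqNgt (site_subshape la_le).
Qed.

(** A word of nonzero weight with the right end is sound and closed in each row, hence is the word
    of a tableau. *)
Lemma LLT_chain : LLT la x t = chain n (weight1 t xs) n (conf_of S' (part la)).
Proof.
rewrite chain_words (bigID (fun u => u \in [set tableau_word S' T | T in @is_tableau n k.+1 la])) /=.
rewrite [X in _ = _ + X]big1 ?addr0 => [|u nu].
  rewrite big_imset /=; last exact: tableau_word_inj.
  apply: eq_bigr => T tab; rewrite tableau_word_weight // nth_tableau_word //.
  by rewrite (eq_conf_of _ (subshapen T)) eqxx mulr1.
case: eqP => [last_u|]; last by rewrite mulr0.
rewrite mulr1; apply/eqP; apply: contraNT nu => nz.
have nz_i i : (i < n)%N -> weight1 t xs i (nth vac (vac :: u) i) (nth vac (vac :: u) i.+1) != 0.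
  move=> lt_in; apply: contraNneq nz => e.
  by rewrite (bigD1 (Ordinal lt_in)) //= e mul0r.
have [||T tab <-] := @tableau_word_surj n k S' la n_gt0 n_le la_le u _ _ last_u.
- move=> i s c lt_in sS; apply: contraNT (nz_i i lt_in) => h; apply/eqP.
  exact: weight1_unsound sS h.
- move=> i lt_in; apply: contraNT (nz_i i lt_in) => h; apply/eqP.
  exact: weight1_open.
by apply/imsetP; exists T.
Qed.
End LLTWeights.

(** * The Cauchy identity *)

Section Statistic.
Variables (n k : nat).
Local Notation K := 'I_k.+1.
Implicit Types h : K -> 'I_n -> nat.

Lemma inversions_bits_of h S : nonincreasing h -> (forall c r, (site h c r < S)%N) ->
  (inversions (bits_of h) S = \sum_(a : K) \sum_(b : K | a < b)
     \sum_(j : 'I_n) \sum_(i : 'I_n) (site h b i < site h a j))%N.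
Proof.
move=> dh hS; rewrite /inversions exchange_big /=; apply: eq_bigr => a _.
rewrite exchange_big /=; apply: eq_bigr => b _.
under eq_bigr do rewrite (bits_ofE _ _ dh) big_distrl /=.
rewrite exchange_big /=; apply: eq_bigr => j _.
rewrite (bigD1 (Ordinal (hS a j))) //= eqxx mul1n big1 ?addn0 => [|s ne].
  exact: particles_of.
by rewrite eq_sym (_ : (_ == _) = false) //; apply: contra_neqF ne => /eqP e; apply: ord_inj.
Qed.

Lemma sum_ord_lt m : (\sum_(j < m) \sum_(i < m) (j < i) = 'C(m, 2))%N.
Proof.
rewrite exchange_big -bin2_sum big_mkord; apply: eq_bigr => i _.
rewrite -(big_mkord xpredT (fun j => (j < i)%N : nat)) (@big_cat_nat _ _ _ i) //=; last exact: ltnW.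
rewrite (eq_big_nat _ _ (F2 := fun=> 1%N)) => [|j /andP[_ ->] //].
rewrite sum_nat_const_nat subn0 muln1 big1_seq ?addn0 // => j.
by rewrite mem_index_iota /= => /andP[le _]; rewrite ltnNge le.
Qed.

(** In the vacuum all colours occupy the same sites, so each pair of colours has one inversion for
    each pair of distinct rows. This is the origin of the constant in [dstat]. *)
Lemma inversions_vacuum S' : (n <= S'.+1)%N ->
  inversions (bit (vacuum k S' n)) S'.+1 = ('C(n, 2) * 'C(k.+1, 2))%N.
Proof.
move=> n_le; rewrite -conf_of0 bit_conf_of => [|c r]; last first.
  by rewrite /site; have := ltn_ord r; lia.
rewrite inversions_bits_of // => [|c r]; last by rewrite /site; have := ltn_ord r; lia.
rewrite -(sum_ord_lt k.+1) big_distrr /=; apply: eq_bigr => a _.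
rewrite big_distrr big_mkcond /=; apply: eq_bigr => b _; case: (a < b)%N; rewrite ?muln0 //.
rewrite muln1 -sum_ord_lt; apply: eq_bigr => j _; apply: eq_bigr => i _; congr nat_of_bool.
by rewrite /site; have := ltn_ord i; have := ltn_ord j; lia.
Qed.

Lemma dstat_inversions (la : mpartition n k.+1) S : (forall c r, (site (part la) c r < S)%N) ->
  dstat la = ('C(n, 2) * 'C(k.+1, 2))%N%:Z - (inversions (bits_of (part la)) S)%:Z.
Proof.
move=> laS; rewrite /dstat; congr (_ - Posz _).
rewrite inversions_bits_of //; last exact: part_nonincreasing.
rewrite -sum1dep_card big_mkcond /=.
rewrite (eq_bigr (fun q : ('I_n * 'I_n) * (K * K) => ((q.2.1 < q.2.2) *
   (site (part la) q.2.2 q.1.1 < site (part la) q.2.1 q.1.2))%N)); last first.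
  move=> [[i j] [a b]] _ /=; case: ifP => h.
    case/andP: h => -> h; rewrite mul1n; suff -> : (site (part la) b i < site (part la) a j)%N by [].
    by move: h; rewrite /site; have := ltn_ord i; have := ltn_ord j; lia.
  case: (a < b)%N h => //= h; rewrite mul1n; apply/esym/eqP; rewrite eqb0.
  by move: h; rewrite /site; have := ltn_ord i; have := ltn_ord j; lia.
rewrite -(pair_bigA _ (fun (p : 'I_n * 'I_n) (q : K * K) => ((q.1 < q.2) *
   (site (part la) q.2 p.1 < site (part la) q.1 p.2))%N)) /=.
rewrite exchange_big /= -(pair_bigA _ (fun a b : K => \sum_(p : 'I_n * 'I_n) ((a < b) *
   (site (part la) b p.1 < site (part la) a p.2)))%N) /=.
apply: eq_bigr => a _; rewrite [RHS]big_mkcond; apply: eq_bigr => b _.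
case: (a < b)%N; last by rewrite big1.
rewrite -(pair_bigA _ (fun i j : 'I_n => 1 * (site (part la) b i < site (part la) a j))%N) /=.
rewrite exchange_big /=; apply: eq_bigr => j _; apply: eq_bigr => i _.
by rewrite mul1n.
Qed.
End Statistic.

Section Partitions.
Variables (n k : nat).
Local Notation K := 'I_k.+1.

Lemma mpartition_eq (la mu : mpartition n k.+1) :
  (forall c r, part la c r = part mu c r) -> la = mu.
Proof.
by move=> e; apply/ffunP => c; apply/val_inj/eq_from_tnth => r; apply: e.
Qed.

Lemma mpartition_of (h : K -> 'I_n -> nat) : nonincreasing h ->
  exists la : mpartition n k.+1, forall c r, part la c r = h c r.
Proof.
move=> dh; have srt c : sorted geq [tuple h c r | r < n].
  apply/(sortedP 0%N) => i; rewrite size_tuple => lt_in.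
  rewrite -[nth _ _ i]/(nth 0%N [tuple h c r | r < n] (Ordinal (ltnW lt_in))).
  rewrite -[nth _ _ i.+1]/(nth 0%N [tuple h c r | r < n] (Ordinal lt_in)).
  by rewrite -!tnth_nth !tnth_mktuple /=; apply: dh => /=.
exists [ffun c => exist (fun p : n.-tuple nat => is_true (sorted geq p)) _ (srt c)] => c r.
by rewrite /part ffunE /= tnth_mktuple.
Qed.
End Partitions.

(** * Degree estimates for power series *)

Section LowDegree.
Variables (N : nat) (R : comNzRingType).
Local Notation fps := ({fps R[N]}).
Implicit Types f g : fps.

Definition vanish_below (d : nat) f : Prop :=
  forall m : 'X_{1..N}, (mdeg m < d)%N -> fps_coef f m = 0.

Lemma vanish_zero d : vanish_below d 0. Proof. by []. Qed.
Lemma vanish_any f : vanish_below 0 f. Proof. by []. Qed.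

Lemma vanish_add d f g : vanish_below d f -> vanish_below d g -> vanish_below d (f + g).
Proof. by move=> hf hg m md; rewrite fps_coefD hf ?hg ?addr0. Qed.

Lemma vanish_mul d e f g :
  vanish_below d f -> vanish_below e g -> vanish_below (d + e) (f * g).
Proof.
move=> hf hg m md; rewrite fps_coefM big1 // => l le_lm.
have [ld|dl] := ltnP (mdeg l) d; first by rewrite hf ?mul0r.
have e1 : (mdeg (m - l)%MM + mdeg l)%N = mdeg m by rewrite -mdegD submK.
by rewrite hg ?mulr0 //; lia.
Qed.

Lemma vanish_weak d e f : (e <= d)%N -> vanish_below d f -> vanish_below e f.
Proof. by move=> ed hf m me; apply: hf; apply: leq_trans me ed. Qed.

Lemma vanish_fpsX i : vanish_below 1 (fpsX R i).
Proof.
move=> m; rewrite ltnS leqn0 mdeg_eq0 => /eqP-> /=.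
by case: eqP => // /(congr1 (@mdeg N)); rewrite mdeg0 mdeg1.
Qed.

(** A single row already supplies as many variables as it has cells. *)
Lemma vanish_LLT n k (la : mpartition n k) (x : 'I_n -> fps) t c r :
  (forall i, vanish_below 1 (x i)) -> vanish_below (part la c r) (LLT la x t).
Proof.
move=> hx; rewrite /LLT; elim/big_ind: _ => //; first exact: vanish_add.
move=> T _; rewrite -[part la c r]add0n; apply: vanish_mul => //.
have := J_prod vanish_any vanish_mul (I := cell la) (d := fun=> 1%N)
  (F := fun u => x (T u)) (fun u => hx (T u)).
apply: vanish_weak; rewrite sum1_card -[X in (X <= _)%N]card_ord.
pose f (j : 'I_(part la c r)) : cell la :=
  Tagged (fun p : 'I_k * 'I_n => 'I_(part la p.1 p.2)) (i := (c, r)) j.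
have f_inj : injective f by move=> j j' /eqP; rewrite eq_Tagged /= => /eqP.
by rewrite -(card_codom f_inj) max_card.
Qed.
End LowDegree.

(** * Partitions in a box *)

Section Enumeration.
Variables (n k S' : nat).
Local Notation K := 'I_k.+1.
Local Notation S := S'.+1.
Local Notation conf := (conf k S').
Hypothesis n_gt0 : (0 < n)%N.

Definition in_box (la : mpartition n k.+1) : Prop := forall c r, (part la c r + n <= S)%N.

Definition n_packed (C : conf) : bool := [forall c, particles (bit C) c S == n].

Lemma in_box_site la : in_box la <-> forall c r, (site (part la) c r < S)%N.
Proof.
split=> [box c r|h c r]; first by have := box c r; have := ltn_ord r; rewrite /site; lia.
have le0 : (part la c r <= part la c (Ordinal n_gt0))%N by apply: part_nonincreasing.
by have := h c (Ordinal n_gt0); move: le0; rewrite /site /=; lia.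
Qed.

(** The list is the image of the finite set of [n_packed] configurations under a choice of shapes,
    so sums over it become sums over configurations. *)
Lemma box_enum : exists s : seq (mpartition n k.+1),
  [/\ uniq s, forall la, la \notin s -> exists c r, (S < part la c r + n)%N,
      forall la, la \in s -> in_box la
    & forall (V : zmodType) (G : conf -> V),
      \sum_(la <- s) G (conf_of S' (part la)) = \sum_(C | n_packed C) G C].
Proof.
have ex C : exists la, n_packed C -> in_box la /\ C = conf_of S' (part la).
  have [/forallP pk|] := boolP (n_packed C); last first.
    have [la _] := @mpartition_of n k (fun _ _ => 0%N) (fun _ _ _ _ => leqnn _).
    by exists la.
  have [h [dh hS hE]] := bits_of_surj (fun c => eqP (pk c)).
  have [la laE] := mpartition_of dh; exists la => _.
  have eh : part la = h by apply/funext => c; apply/funext => r.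
  split; first by apply/in_box_site; rewrite eh.
  by apply: conf_eq => s c sS; rewrite eh bit_conf_of // hE.
have [f fP] := choice ex.
have f_inj : {in [seq C <- enum {: conf} | n_packed C] &, injective f}.
  move=> C D; rewrite !mem_filter => /andP[/fP[_ eC] _] /andP[/fP[_ eD] _] e.
  by rewrite eC eD e.
exists [seq f C | C <- enum {: conf} & n_packed C]; split.
- by rewrite map_inj_in_uniq // filter_uniq // enum_uniq.
- move=> la nla; have [out|box] := pselect (exists c r, (S < part la c r + n)%N) => //.
  case/negP: nla.
  have {}box : in_box la.
    by move=> c r; rewrite leqNgt; apply/negP => lt; apply: box; exists c, r.
  have pk : n_packed (conf_of S' (part la)).
    have laS := (in_box_site la).1 box; apply/forallP => c.
    rewrite bit_conf_of // particles_of; last exact: part_nonincreasing.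
    by rewrite (eq_bigr (fun=> 1%N)) ?sum1_card ?card_ord // => r _; rewrite laS.
  have [fbox /conf_of_inj e] := fP _ pk.
  suff -> : la = f (conf_of S' (part la)).
    by apply: map_f; rewrite mem_filter pk mem_enum.
  apply: mpartition_eq; apply: e; try exact: part_nonincreasing.
    exact/in_box_site.
  exact/in_box_site.
- by move=> la /mapP[C]; rewrite mem_filter => /andP[/fP[box _] _] ->.
move=> V G; rewrite big_map big_filter big_enum_cond /=.
by apply: eq_bigr => C /fP[_ <-].
Qed.
End Enumeration.

Lemma fps_unitI N (R : comUnitRingType) (f : {fps R[N]}) :
  fps_coef f 0%MM \is a GRing.unit -> f \is a GRing.unit.
Proof. by []. Qed.

Lemma exprz_sub_mul (R : comUnitRingType) (t v w : R) (a b : nat) :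
  t \is a GRing.unit -> v * t ^+ a = w * t ^+ b -> t ^ (a%:Z - b%:Z) * v = w.
Proof.
move=> ut e; apply: (mulIr (unitrX b ut)).
by rewrite -e mulrAC exprnP -exprzDr // subrK mulrC.
Qed.

Lemma LLT_cauchy (n k : nat) (F : fieldType) (q : F) : (0 < n)%N -> q != 0 ->
  let t : {fps F[n + n]} := fpsC (n + n) q in
  let x (i : 'I_n) : {fps F[n + n]} := fpsX F (lshift n i) in
  let y (j : 'I_n) : {fps F[n + n]} := fpsX F (rshift n j) in
  fps_has_sum
    (fun la : mpartition n k.+1 => t ^ dstat la * LLT la x t * LLT la y t)
    (\prod_(i < n) \prod_(j < n) \prod_(m < k.+1) (1 - x i * y j * t ^+ m)^-1).
Proof.
move=> hn q_neq0 t x y.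
have t_unit : t \is a GRing.unit.
  by apply: fps_unitI; rewrite fps_coefC eqxx unitfE.
have x1 i : vanish_below 1 (x i) by exact: vanish_fpsX.
have y1 i : vanish_below 1 (y i) by exact: vanish_fpsX.
pose ext (z : 'I_n -> {fps F[n + n]}) (l : nat) := oapp z 0 (insub l).
have extE z (i : 'I_n) : ext z i = z i by rewrite /ext valK.
have ext1 z : (forall i, vanish_below 1 (z i)) -> forall l, vanish_below 1 (ext z l).
  by move=> hz l; rewrite /ext; case: insubP => [i _ _|_] //=; exact: hz.
(* The strip has [n + mdeg m + 1] sites, so the errors begin in degree [mdeg m + 1], beyond the
   coefficient at [m]. *)
move=> m; pose S' := (n + mdeg m)%N.
have n_le : (n <= S'.+1)%N by rewrite /S'; lia.
have [s [s_uniq s_out s_box s_sum]] := @box_enum n k S' hn.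
exists s; split=> // [la /s_out[c [r lt]]|].
  have deg : ((mdeg m).+1 <= part la c r)%N by move: lt; rewrite /S'; lia.
  have hx := vanish_weak deg (@vanish_LLT _ _ _ _ la x t c r x1).
  rewrite mulrAC; exact: (vanish_mul (@vanish_any _ _ (t ^ dstat la * LLT la y t)) hx).
pose fx := chain n (weight1 t (ext x)) n : conf k S' -> _.
pose fy := chain n (weight2 t (ext y)) n : conf k S' -> _.
have termE la : la \in s -> t ^ dstat la * LLT la x t * LLT la y t =
    fx (conf_of S' (part la)) * fy (conf_of S' (part la)).
  move=> /s_box box; have laS := (in_box_site S' hn la).1 box.
  rewrite (LLT_chain hn n_le box t (extE x)) (LLT_chain hn n_le box t (extE y)).
  rewrite -mulrA mulrCA /fx /fy; congr (_ * _).
  rewrite (dstat_inversions laS) -(inversions_vacuum k n_le); apply: exprz_sub_mul => //.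
  have e := chain_inversions t (ext y) n n (conf_of S' (part la)).
  rewrite (bit_conf_of laS) in e; exact: e.
transitivity (fps_coef (\sum_(C : conf k S') fx C * fy C) m).
  rewrite (eq_big_seq (fun la => fps_coef (fx (conf_of S' (part la)) * fy (conf_of S' (part la))) m)).
    rewrite (s_sum _ (fun C => fps_coef (fx C * fy C) m)) fps_coef_sum.
    rewrite big_mkcond; apply: eq_bigr => C _; case: ifPn => // /forallPn[c nc].
    rewrite (_ : fy C = 0) ?mulr0 //; apply/eqP; apply: contraNT nc => nz.
    apply/eqP; exact: (chain_particles n_le (@weight2_unsound _ _ _ t (ext y))
      (@weight2_open _ _ _ t (ext y)) c nz).
  by move=> la /termE ->.
pose P := \prod_(l < n) cauchy_factor k t (ext y) (ext x l) n.
set Q := \prod_(i < n) _.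
have QP : Q * P = 1.
  rewrite /Q /P -big_split big1 //= => i _; rewrite -big_split big1 //= => j _.
  rewrite -big_split big1 //= => l _; rewrite !extE mulVr //.
  apply: fps_unitI.
  rewrite fps_coefB fps_coef1 eqxx -mulrA fps_coefM0.
  by rewrite (x1 i) ?mul0r ?subr0 ?unitr1 // mdeg0.
have := @cauchy_chains k S' _ n n_le hn _ (@vanish_zero _ _) (@vanish_any _ _) (@vanish_add _ _)
  (@vanish_mul _ _) (@vanish_weak _ _) t (ext x) (ext y) (ext1 y y1) n (leqnn n).
rewrite -/P; set W := \sum_C _ => van.
(* Multiplying by the inverse product [Q] does not lower the order of the error and turns
   [P * W - 1] into [W - Q]. *)
have : vanish_below (S'.+1 - n) (Q * (P * W - 1)).
  by rewrite -[X in vanish_below X]add0n; apply: vanish_mul.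
rewrite mulrBr mulrA QP mul1r mulr1 => /(_ m) -/(_ _)/eqP.
rewrite fps_coefB subr_eq0 => h; apply/eqP; apply: h.
by rewrite /S'; lia.
Qed.

(* Coefficients are taken in Q(t), so that t is an invertible indeterminate. *)
Theorem theorem6p1 (n k : nat) (hn : (1 <= n)%N) (hk : (1 <= k)%N) :
  let K := {fraction {poly rat}} in
  let t : {fps K[n + n]} := fpsC (n + n) (tofrac ('X : {poly rat})) in
  let x (i : 'I_n) : {fps K[n + n]} := fpsX K (lshift n i) in
  let y (j : 'I_n) : {fps K[n + n]} := fpsX K (rshift n j) in
  fps_has_sum
    (fun la : mpartition n k => t ^ dstat la * LLT la x t * LLT la y t)
    (\prod_(i < n) \prod_(j < n) \prod_(m < k) (1 - x i * y j * t ^+ m)^-1).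
Proof.
case: k hk => [//|k] _ K t x y.
by apply: LLT_cauchy => //; rewrite tofrac_eq0 polyX_eq0.
Qed.
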